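(* Let $k$ be a field of characteristic $0$, $R = k[t_1, \dots, t_n]$, and $x_1, \dots, x_m \in (k^* )^n$. Let $N > 0$ and suppose there exists a nonzero $P \in R$ with total degree $\deg(P) < (N/n)^{m/n}$ such that $P(x) = 0$ for all $x \in X(N)$. Then there exists a prime ideal $\mathfrak{p} \subset \mathfrak{m}$ of some height $n'$ such that $\operatorname{rank}(\operatorname{Stab}_X(\mathfrak{p})) = m'$ with $m'/m + n'/n > 1$.
   Context: $X(N) = \{\prod_{i=1}^m x_i^{a_i} : a_i \in \mathbf{Z},\ 0 \le a_i \le N\} \subset (k^* )^n$, products taken coordinatewise; for $a \in \mathbf{Z}^m$ write $x^a = \prod_i x_i^{a_i}$. $\mathfrak{m} = (t_1 - 1, \dots, t_n - 1)$. An element $z \in (k^* )^n$ acts on $R$ by $(z \cdot f)(t) = f(z_1t_1, \dots, z_nt_n)$, and $\operatorname{Stab}_X(\mathfrak{p}) = \{a \in \mathbf{Z}^m : x^a \cdot \mathfrak{p} = \mathfrak{p}\}$. *)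

(* Defs.v *)
From HB Require Import structures.
From mathcomp Require Import all_boot all_order all_algebra.
From mathcomp Require Export mpoly.
Set Implicit Arguments. Unset Strict Implicit. Unset Printing Implicit Defensive.
Import Order.TTheory GRing.Theory Num.Theory.
Local Open Scope ring_scope.

Section Defs.
Variables (k : fieldType) (n : nat).

Definition polyset := {mpoly k[n]} -> Prop.

Definition is_ideal (I : polyset) : Prop :=
  [/\ I 0,
      (forall f g, I f -> I g -> I (f + g)) &
      (forall r f, I f -> I (r * f))].

Definition is_prime_ideal (I : polyset) : Prop :=
  [/\ is_ideal I, ~ I 1 & (forall f g, I (f * g) -> I f \/ I g)].

Definition subset_ideal (I J : polyset) : Prop := forall f, I f -> J f.

Definition strict_subset_ideal (I J : polyset) : Prop :=
  subset_ideal I J /\ exists f, J f /\ ~ I f.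

Definition prime_chain_to (p : polyset) (h : nat) : Prop :=
  exists c : nat -> polyset,
    [/\ (forall i, (i <= h)%N -> is_prime_ideal (c i)),
        (forall i, (i < h)%N -> strict_subset_ideal (c i) (c i.+1)) &
        c h = p].

Definition has_height (p : polyset) (h : nat) : Prop :=
  prime_chain_to p h /\ forall h', prime_chain_to p h' -> (h' <= h)%N.

Definition mideal : polyset :=
  fun f => exists g : 'I_n -> {mpoly k[n]}, f = \sum_(i < n) g i * ('X_i - 1).

Definition act (z : 'I_n -> k) (f : {mpoly k[n]}) : {mpoly k[n]} :=
  comp_mpoly (mktuple (fun i : 'I_n => z i *: 'X_i)) f.

Definition act_fixes (z : 'I_n -> k) (I : polyset) : Prop :=
  (forall f, I f -> I (act z f)) /\
  (forall g, I g -> exists f, I f /\ act z f = g).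

Definition xpow (m : nat) (x : 'I_m -> 'I_n -> k) (a : 'I_m -> int) : 'I_n -> k :=
  fun j => \prod_(i < m) (x i j) ^ (a i).

Definition Stab (m : nat) (x : 'I_m -> 'I_n -> k) (p : polyset) : ('I_m -> int) -> Prop :=
  fun a => act_fixes (xpow x a) p.

End Defs.

Definition Zindep (m r : nat) (v : 'I_r -> 'I_m -> int) : Prop :=
  forall c : 'I_r -> int,
    (forall j : 'I_m, \sum_(i < r) c i * v i j = 0) -> forall i, c i = 0.

Definition has_rank (m : nat) (S : ('I_m -> int) -> Prop) (r : nat) : Prop :=
  (exists v : 'I_r -> 'I_m -> int, (forall i, S (v i)) /\ Zindep v) /\
  (forall v : 'I_r.+1 -> 'I_m -> int, (forall i, S (v i)) -> ~ Zindep v).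

Definition totdeg (k : fieldType) (n : nat) (P : {mpoly k[n]}) : nat := (msize P).-1.

(* Main.v *)
Require Import Defs.
From HB Require Import structures.
From mathcomp Require Import all_boot all_order all_algebra.
From mathcomp Require Import mpoly.
From mathcomp Require Import zify ring.
From Stdlib Require Import Classical ClassicalEpsilon.
Set Implicit Arguments. Unset Strict Implicit. Unset Printing Implicit Defensive.
Import Order.TTheory GRing.Theory Num.Theory.
Local Open Scope ring_scope.

(* Let Q be the integer part of N/n and d the degree of P.  For r = 0, ..., n consider the primes
   that contain all translates of P by X(rQ) and vanish at some point of X(N - rQ), and let h_r be
   their least height.  These heights increase with r and lie between 1 and n, so h_r = h_(r+1) for
   some r.  A prime p realising h_(r+1) has the property that all its translates by X(Q) are minimal
   over the ideal generated by the translates of P by X(rQ), and they have the same height n'.  By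
   Bezout there are at most d^n' of them; on the other hand m - m' coordinate directions are
   independent modulo the stabiliser, so there are at least (Q + 1)^(m - m').  Comparing with
   d < (N/n)^(m/n) gives the inequality, and a translate of p lies in the ideal of the point 1.

   Bezout's bound is obtained by counting.  If f of degree at most d is a nonzerodivisor modulo I
   and J contains I and f, then dim (R/I)_D >= dim (R/J)_D + dim (R/I)_(D - d), where the index D
   bounds the degree.  A chain of h such steps starting at I = 0 and ending in the intersection of
   M primes of height h yields M <= d^h on comparing leading terms in D.  That general linear
   combinations of the given equations provide such a chain rests on Krull's height theorem, which
   follows from computing the growth of R/p^l in two ways: it is at most that of monomials in the
   equations, and, by differentiation, at least that of monomials in the variables that are
   algebraic over a transcendence basis modulo p. *)

(** Classical truth values as Booleans, so that [ex_minnP], [ex_maxnP] and [arg_maxnP] apply to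
    arbitrary propositions. *)
Definition asb (P : Prop) : bool := if excluded_middle_informative P then true else false.

Lemma asbP (P : Prop) : reflect P (asb P).
Proof. by rewrite /asb; case: excluded_middle_informative => h; constructor. Qed.

Section CharZero.
Variable k : fieldType.
Hypothesis char0 : [pchar k] =i pred0.

Lemma natr_eq0_char0 a : (a%:R == 0 :> k) = (a == 0)%N.
Proof. exact: ((pcharf0P k).1 char0). Qed.

Lemma natr_inj_char0 : injective (fun a : nat => a%:R : k).
Proof.
move=> a b /= e; wlog leab : a b e / (a <= b)%N.
  by move=> W; case: (leqP a b) => [|/ltnW] h; [apply: W | symmetry; apply: W].
apply/eqP; rewrite eqn_leq leab /= -subn_eq0 -natr_eq0_char0 natrB //.
by rewrite e subrr.
Qed.

Variable n : nat.
Local Notation R := {mpoly k[n]}.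
Implicit Types (I J P Q : polyset k n) (f g u v : R).

(** * Ideals and primes *)

Section IdealTheory.
Variable I : polyset k n.
Hypothesis idI : is_ideal I.

Lemma ideal0 : I 0. Proof. by case: idI. Qed.
Lemma idealD f g : I f -> I g -> I (f + g). Proof. by case: idI => _ h _; apply: h. Qed.
Lemma idealM r f : I f -> I (r * f). Proof. by case: idI => _ _; apply. Qed.
Lemma idealMr r f : I f -> I (f * r). Proof. by rewrite mulrC; apply: idealM. Qed.
Lemma idealZ c f : I f -> I (c *: f). Proof. by rewrite -mul_mpolyC; apply: idealM. Qed.
Lemma idealN f : I f -> I (- f). Proof. by rewrite -mulN1r; apply: idealM. Qed.
Lemma idealB f g : I f -> I g -> I (f - g).
Proof. by move=> hf hg; apply: idealD => //; apply: idealN. Qed.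
Lemma idealDr f g : I g -> I (f + g) -> I f.
Proof. by move=> hg /idealB /(_ hg); rewrite addrK. Qed.
Lemma ideal_sum (T : Type) (r : seq T) (p : pred T) (F : T -> R) :
  (forall i, p i -> I (F i)) -> I (\sum_(i <- r | p i) F i).
Proof. by move=> h; apply: big_ind => //; [apply: ideal0 | apply: idealD]. Qed.
End IdealTheory.

Section PrimeTheory.
Variable P : polyset k n.
Hypothesis prP : is_prime_ideal P.

Lemma prime_ideal : is_ideal P. Proof. by case: prP. Qed.
Lemma prime_N1 : ~ P 1. Proof. by case: prP. Qed.
Lemma primeM f g : P (f * g) -> P f \/ P g. Proof. by case: prP => _ _; apply. Qed.
Lemma primeNM f g : ~ P f -> ~ P g -> ~ P (f * g).
Proof. by move=> hf hg /primeM []. Qed.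
Lemma prime_prod (T : Type) (r : seq T) (p : pred T) (F : T -> R) :
  (forall i, p i -> ~ P (F i)) -> ~ P (\prod_(i <- r | p i) F i).
Proof.
by move=> h; apply: (big_ind (fun f => ~ P f)) => //; [exact: prime_N1 | exact: primeNM].
Qed.
Lemma primeX f a : P (f ^+ a) -> P f.
Proof.
elim: a => [|a IH]; first by rewrite expr0 => /prime_N1.
by rewrite exprS => /primeM [].
Qed.
Lemma prime_const c : P c%:MP -> c = 0.
Proof.
move=> h; apply/eqP; apply: contraPT h => c0 h; apply: prime_N1.
suff -> : 1 = (c^-1)%:MP * c%:MP :> R by apply: idealM => //; apply: prime_ideal.
by rewrite -mpolyCM mulVf // mpolyC1.
Qed.
End PrimeTheory.

(** * Interpolation over an infinite field *)

Section Interpolation.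

(** Weaker than an ideal, so that interpolation also covers the polynomials in a subset of the
    variables. *)
Definition kspace (I : polyset k n) :=
  [/\ I 0, forall f g, I f -> I g -> I (f + g) & forall c f, I f -> I (c *: f)].

Lemma ideal_kspace I : is_ideal I -> kspace I.
Proof.
by move=> h; split; [apply: ideal0 | move=> *; apply: idealD | move=> *; apply: idealZ].
Qed.

(** Induction on the points. In [F = G * ('X - c) + F(c)] the quotient takes at another point [e]
    the value [(F(e) - F(c)) / (e - c)], which stays in [I]; so the coefficients of [G], and then
    those of [F], lie in [I]. *)
Lemma interpolation I (F : {poly R}) (s : seq k) :
  kspace I -> uniq s -> (size F <= size s)%N ->
  (forall c, c \in s -> I F.[c%:MP]) -> forall a, I F`_a.
Proof.
move=> [I0 ID IZ]; elim: s F => [|c s IH] F /=.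
  by move=> _; rewrite leqn0 size_poly_eq0 => /eqP-> _ a; rewrite coef0.
move=> /andP[cs us] sF h.
have hc : I F.[c%:MP] by apply: h; rewrite mem_head.
have /factor_theorem [G eG] : root (F - (F.[c%:MP])%:P) c%:MP.
  by rewrite /root !hornerE subrr.
have eF : F = G * ('X - c%:MP%:P) + (F.[c%:MP])%:P by rewrite -eG subrK.
have sG : (size G <= size s)%N.
  have [->|G0] := eqVneq G 0; first by rewrite size_poly0.
  have : (size (G * ('X - (c%:MP)%:P))%R <= size F)%N.
    rewrite -eG; apply: leq_trans (size_polyD _ _) _.
    rewrite size_polyN geq_max leqnn /=; apply: leq_trans (size_polyC_leq1 _) _.
    rewrite lt0n size_poly_eq0; apply/eqP => F0; move: eG.
    rewrite F0 horner0 subrr => /esym/eqP.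
    by rewrite mulf_eq0 (negPf G0) polyXsubC_eq0.
  rewrite size_Mmonic ?monicXsubC // size_XsubC addn2 /=.
  by move=> /leq_trans /(_ sF).
have hG : forall a, I G`_a.
  apply: IH => // e es.
  have ne : e - c != 0 by rewrite subr_eq0; apply: contraNneq cs => <-.
  have -> : G.[e%:MP] = (e - c)^-1 *: (F.[e%:MP] + (-1) *: F.[c%:MP]).
    rewrite {1}eF !hornerE scaleN1r addrK -mul_mpolyC mulrCA -mpolyCB -mpolyCM mulVf //.
    by rewrite mpolyC1 mulr1.
  by apply: (IZ); apply: (ID); [apply: h; rewrite inE es orbT | apply: (IZ)].
move=> a; rewrite eF coefD coefC mulrBr coefB coefMX mulrC mul_polyC coefZ.
apply: (ID); last by case: ifP.
apply: (ID); first by case: ifP.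
by rewrite -scaleN1r mul_mpolyC; apply: (IZ); apply: (IZ).
Qed.

Lemma interpolation_all I (F : {poly R}) : kspace I ->
  (forall c, I F.[c%:MP]) -> forall a, I F`_a.
Proof.
move=> hI h; apply: (@interpolation _ _ [seq i%:R | i <- iota 0 (size F)]) => //.
  by rewrite map_inj_uniq ?iota_uniq //; apply: natr_inj_char0.
by rewrite size_map size_iota.
Qed.

(* A single value avoids finitely many subspaces at once: each of them excludes fewer than
   [size F] values, and [k] is infinite. *)
Lemma avoid (T : finType) (I : T -> polyset k n) (F : T -> {poly R}) :
  (forall t, kspace (I t)) -> (forall t, exists a, ~ I t (F t)`_a) ->
  exists c, forall t, ~ I t (F t).[c%:MP].
Proof.
move=> hI hF; apply: NNPP => hn.
pose s : seq k := [seq i%:R | i <- iota 0 (\sum_t size (F t)).+1].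
have us : uniq s by rewrite map_inj_uniq ?iota_uniq //; apply: natr_inj_char0.
pose bad t := [seq c <- s | asb (I t (F t).[c%:MP])].
have sbad t : (size (bad t) <= size (F t))%N.
  case: (leqP (size (bad t)) (size (F t))) => // /ltnW h.
  case: (hF t) => a []; apply: (interpolation (hI t) _ h).
    exact: filter_uniq.
  by move=> c; rewrite mem_filter => /andP[/asbP].
suff : (size s <= \sum_t size (bad t))%N.
  move=> h; have := leq_trans h (leq_sum _ (fun t _ => sbad t)).
  by rewrite size_map size_iota ltnn.
apply: leq_trans (_ : size (flatten [seq bad t | t <- enum T]) <= _)%N.
  apply: uniq_leq_size => // c cs; apply: NNPP => hc; apply: hn; exists c => t ht.
  apply: hc; apply/flatten_mapP; exists t; first by rewrite mem_enum.
  by rewrite mem_filter cs andbT; apply/asbP.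
by rewrite size_flatten /shape -map_comp sumnE big_map big_enum.
Qed.

End Interpolation.

Lemma mpoly_rmorph_eq (S : comNzRingType) (phi psi : {rmorphism R -> S}) :
  (forall c, phi c%:MP = psi c%:MP) -> (forall i, phi 'X_i = psi 'X_i) -> phi =1 psi.
Proof.
move=> hC hX f; rewrite (mpolyE f) !rmorph_sum; apply: eq_bigr => m _.
rewrite -mul_mpolyC !rmorphM hC mpolyXE_id !rmorph_prod; congr (_ * _).
by apply: eq_bigr => i _; rewrite !rmorphXn hX.
Qed.

(** * Specialising a variable *)

Section Spec.
Variable j : 'I_n.

Definition spec (c : k) : R -> R :=
  comp_mpoly [tuple (if i == j then c%:MP else 'X_i) | i < n].

HB.instance Definition _ c := GRing.RMorphism.copy (spec c) (spec c).

Lemma specC c b : spec c b%:MP = b%:MP. Proof. by rewrite /spec comp_mpolyC. Qed.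
Lemma specX c i : spec c 'X_i = if i == j then c%:MP else 'X_i.
Proof. by rewrite /spec comp_mpolyXU -tnth_nth tnth_mktuple. Qed.
Lemma specZ c b f : spec c (b *: f) = b *: spec c f.
Proof. by rewrite -mul_mpolyC rmorphM /= specC mul_mpolyC. Qed.

(** The coefficients stay in the full ring [R], where they can be tested against ideals. Evaluation
    at a constant specialises the variable [j]; evaluation at ['X_j] gives the polynomial back. *)
Definition unipoly : R -> {poly R} :=
  mmap (polyC \o @mpolyC n k) (fun i => if i == j then 'X else ('X_i)%:P).

HB.instance Definition _ := GRing.RMorphism.copy unipoly unipoly.

Lemma unipolyC b : unipoly b%:MP = (b%:MP)%:P. Proof. by rewrite /unipoly mmapC. Qed.
Lemma unipolyX i : unipoly 'X_i = if i == j then 'X else ('X_i)%:P.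
Proof. by rewrite /unipoly mmapX mmap1U. Qed.

Lemma unipoly_horner_spec f c : (unipoly f).[c%:MP] = spec c f.
Proof.
apply: (@mpoly_rmorph_eq _ (horner_eval c%:MP \o unipoly) (spec c)) => [b|i] /=.
  by rewrite unipolyC specC /horner_eval hornerC.
by rewrite unipolyX specX /horner_eval; case: eqP; rewrite ?hornerX ?hornerC.
Qed.

Lemma unipoly_hornerX f : (unipoly f).['X_j] = f.
Proof.
apply: (@mpoly_rmorph_eq _ (horner_eval 'X_j \o unipoly) idfun) => [b|i] /=.
  by rewrite unipolyC /horner_eval hornerC.
by rewrite unipolyX /horner_eval; case: eqP => [->|_]; rewrite ?hornerX ?hornerC.
Qed.

Lemma spec_mono c m : spec c 'X_[m] = \prod_i (if i == j then c%:MP else 'X_i) ^+ m i.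
Proof.
rewrite mpolyXE_id rmorph_prod; apply: eq_bigr => i _.
by rewrite rmorphXn /= specX.
Qed.

Lemma mderiv0_mcoeff f (m : 'X_{1..n}) : f^`M(j) = 0 -> m j != 0%N -> f@_m = 0.
Proof.
move=> df mj; have Ujm : (U_(j) <= m)%MM by rewrite lep1mP.
have := mcoeff_deriv j (m - U_(j))%MM f.
rewrite df mcoeff0 submK // => /esym/eqP.
by rewrite -mulr_natr mulf_eq0 natr_eq0_char0 /= orbF => /eqP.
Qed.

Lemma spec_id c f : f^`M(j) = 0 -> spec c f = f.
Proof.
move=> df; rewrite {1}(mpolyE f) [RHS]mpolyE (raddf_sum (spec c)) big_seq [RHS]big_seq.
apply: eq_bigr => m fm; rewrite /= specZ spec_mono mpolyXE_id; congr (_ *: _).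
apply: eq_bigr => i _; case: eqP => [->|//].
suff -> : m j = 0%N by [].
apply/eqP; apply: contraLR fm => mj.
by rewrite -mcoeff_eq0 mderiv0_mcoeff.
Qed.

Lemma mderivX1 (h : R) a i : (h ^+ a)^`M(i) = (h ^+ a.-1 * h^`M(i)) *+ a.
Proof.
elim: a => [|a IH]; first by rewrite expr0 -mpolyC1 mderivC mulr0n.
rewrite exprS mderivM IH /= mulrS (mulrC _ (h ^+ a)); congr (_ + _).
by case: a {IH} => [|a]; rewrite ?mulr0n ?mulr0 //= mulrnAr mulrA -exprS.
Qed.

Lemma mderiv_spec_self c f : (spec c f)^`M(j) = 0.
Proof.
have hX i : (spec c 'X_i)^`M(j) = 0.
  rewrite specX; case: eqP => [_|/eqP ne]; first by rewrite mderivC.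
  by rewrite mderivX mnm1E (negPf ne) scale0r.
rewrite (mpolyE f) (raddf_sum (spec c)) raddf_sum big1 // => m _ /=.
rewrite specZ mderivZ mpolyXE_id rmorph_prod.
suff -> : (\prod_i spec c ('X_i ^+ m i))^`M(j) = 0 by rewrite scaler0.
apply: (big_ind (fun h => h^`M(j) = 0)).
- by rewrite -mpolyC1 mderivC.
- by move=> f1 f2 h1 h2; rewrite mderivM h1 h2 mul0r mulr0 addr0.
- by move=> i _; rewrite rmorphXn mderivX1 hX mulr0 mul0rn.
Qed.

Lemma mderiv_spec c f i : i != j -> f^`M(i) = 0 -> (spec c f)^`M(i) = 0.
Proof.
move=> ij df.
suff -> : (spec c f)^`M(i) = spec c (f^`M(i)) by rewrite df raddf0.
have hX l : (spec c 'X_l)^`M(i) = spec c ('X_l)^`M(i).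
  rewrite specX mderivX mnm1E; case: (eqVneq l j) => [->|ne].
    by rewrite mderivC eq_sym (negPf ij) scale0r raddf0.
  rewrite mderivX mnm1E; case: eqP => [->|_]; last by rewrite !scale0r raddf0.
  by rewrite !scale1r -{1 3}[U_(i)%MM]add0m addmK mpolyX0 rmorph1.
have hM (f1 f2 : R) : (spec c f1)^`M(i) = spec c (f1^`M(i)) ->
    (spec c f2)^`M(i) = spec c (f2^`M(i)) ->
    (spec c (f1 * f2))^`M(i) = spec c ((f1 * f2)^`M(i)).
  by move=> h1 h2; rewrite rmorphM !mderivM h1 h2 rmorphD !rmorphM.
have h1 : (spec c 1)^`M(i) = spec c (1^`M(i)).
  by rewrite rmorph1 -mpolyC1 mderivC raddf0.
rewrite {df} (mpolyE f) (raddf_sum (spec c)) !(raddf_sum (mderiv i)) (raddf_sum (spec c)).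
apply: eq_bigr => m _ /=.
rewrite !(specZ, mderivZ) mpolyXE_id; congr (_ *: _).
apply: (big_ind (fun h => (spec c h)^`M(i) = spec c h^`M(i))) => // l _.
elim: (m l) => [|a IH]; first by rewrite expr0.
by rewrite exprS; apply: hM.
Qed.

End Spec.
End CharZero.

(** * Growth of binomial coefficients *)

Definition psum (r : nat -> nat) (D : nat) : nat := (\sum_(j < D.+1) r j)%N.

Lemma psumS r D : psum r D.+1 = (psum r D + r D.+1)%N.
Proof. by rewrite /psum big_ord_recr. Qed.

Lemma psum_mono r : {homo psum r : a b / (a <= b)%N}.
Proof. by apply: homo_leq => [//|b a c|D]; [apply: leq_trans | rewrite psumS leq_addr]. Qed.

(** From [c] on, this is [M] times the number of monomials of degree at most [D - c] in [s]
    variables; the value 0 below [c] guards against truncated subtraction. *)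
Definition shifted_bin (M c s D : nat) : nat :=
  if (c <= D)%N then (M * 'C(D - c + s, s))%N else 0%N.

Lemma shifted_bin_mono M c s : {homo shifted_bin M c s : a b / (a <= b)%N}.
Proof.
move=> a b ab; rewrite /shifted_bin; case: (leqP c a) => // ca.
rewrite (leq_trans ca ab) leq_mul2l; apply/orP; right.
by rewrite leq_bin2l // leq_add2r leq_sub2r.
Qed.

Lemma psum_shifted_bin M c s : psum (shifted_bin M c s) =1 shifted_bin M c s.+1.
Proof.
elim=> [|D IH].
  rewrite /psum big_ord_recl big_ord0 addn0 /shifted_bin leqn0; case: eqP => // _.
  by rewrite sub0n !add0n !binn.
rewrite psumS IH /shifted_bin; case: (ltngtP c D.+1) => [cD|cD|->].
- rewrite ltnS in cD; rewrite cD -mulnDr; congr (M * _)%N.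
  by rewrite subSn // [X in (_ + 'C(X, _))%N]addSnnS addSn binS.
- by rewrite leqNgt (ltn_trans (ltnSn _) cD).
- by rewrite ltnn subnn !add0n !binn.
Qed.

Lemma iter_psum_shifted_bin M c s h :
  iter h psum (shifted_bin M c s) =1 shifted_bin M c (s + h).
Proof.
elim: h => [|h IH] D; first by rewrite addn0.
rewrite iterS addnS -psum_shifted_bin; apply: eq_bigr => j _; exact: IH.
Qed.

(** The quotient of the two binomials is the product of [(c + E + i) / (E + i)] for [i] from 1 to
    [n], whose largest factor is the first. *)
Lemma bin_shift_le n c E :
  ('C(c + E + n, n) * E.+1 ^ n <= 'C(E + n, n) * (c + E).+1 ^ n)%N.
Proof.
elim: n => [|n IH]; first by rewrite !bin0.
rewrite -(leq_pmul2l (ltn0Sn n)) !expnS !mulnA.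
have bS a : (n.+1 * 'C(a + n.+1, n.+1) = (a + n).+1 * 'C(a + n, n))%N.
  by rewrite addnS -mul_bin_diag.
rewrite !bS.
have -> : ((c + E + n).+1 * 'C(c + E + n, n) * E.+1 * E.+1 ^ n
  = ((c + E + n).+1 * E.+1) * ('C(c + E + n, n) * E.+1 ^ n))%N by nia.
have -> : ((E + n).+1 * 'C(E + n, n) * (c + E).+1 * (c + E).+1 ^ n
  = ((E + n).+1 * (c + E).+1) * ('C(E + n, n) * (c + E).+1 ^ n))%N by nia.
apply: leq_mul => //; nia.
Qed.

(** Bernoulli's inequality for the [n]-th power of [1 - 1/(K+1)], with denominators cleared. *)
Lemma bernoulli_nat K n : ((K.+1 - n) * K.+1 ^ n <= K ^ n * K.+1)%N.
Proof.
elim: n => [|n IH]; first by rewrite subn0 !expn0 mulnC.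
rewrite !expnS; case: (leqP n.+1 K.+1) => h; last first.
  by move: (ltnW h); rewrite -subn_eq0 => /eqP->.
have e : (K.+1 - n = (K.+1 - n.+1).+1)%N by rewrite subSn.
move: IH; rewrite e; set x := (K.+1 - n.+1)%N; move: (K.+1 ^ n)%N (K ^ n)%N => a b IH.
have xK : (x <= K)%N by rewrite /x subSS leq_subr.
have : (x.+1 * a * K <= b * K.+1 * K)%N by rewrite leq_mul2r IH orbT.
nia.
Qed.

(** Read as polynomials in [E], the two sides have degrees [a] and [n] and leading coefficients
    [M/a!] and [W/n!]; large [E] compares first the degrees, then these coefficients. *)
Lemma bin_growth M W c a n : (0 < M)%N ->
  (forall E, M * 'C(E + a, a) <= W * 'C(c + E + n, n))%N ->
  (a <= n)%N /\ (a = n -> (M <= W)%N).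
Proof.
move=> M0 h; split.
  case: (leqP a n) => // na; exfalso.
  have h1 E : (E + n.+1 <= n.+1 * (W * c.+1 ^ n))%N.
    have b1 : ('C(E + n.+1, n.+1) <= 'C(E + a, a))%N.
      rewrite -[X in (_ <= X)%N](@bin_sub _ a) ?leq_addl // addnK.
      rewrite -[X in (X <= _)%N](@bin_sub _ n.+1) ?leq_addl // addnK.
      by rewrite leq_bin2l // leq_add2l.
    have b2 : ('C(E + n.+1, n.+1) <= W * 'C(c + E + n, n))%N.
      by apply: leq_trans b1 (leq_trans _ (h E)); rewrite leq_pmull.
    have b3 : ('C(c + E + n, n) <= 'C(E + n, n) * c.+1 ^ n)%N.
      rewrite -(@leq_pmul2r (E.+1 ^ n)) ?expn_gt0 //.
      apply: leq_trans (bin_shift_le _ _ _) _.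
      rewrite -mulnA leq_mul2l -expnMn; apply/orP; right.
      by have [->|n0] := posnP n; [rewrite !expn0 | rewrite leq_exp2r //; nia].
    have := mul_bin_diag (E + n.+1) n; rewrite {2}addnS /= => e.
    rewrite -(@leq_pmul2r 'C(E + n, n)); last by rewrite bin_gt0 leq_addl.
    rewrite e -!mulnA leq_mul2l /=; apply: leq_trans b2 _.
    by rewrite leq_mul2l [X in (_ <= X)%N]mulnC b3 orbT.
  by have := h1 (n.+1 * (W * c.+1 ^ n))%N; lia.
move=> ean; rewrite {a}ean in h; case: (leqP M W) => // WM; exfalso.
have h2 E : (W.+1 * E.+1 ^ n <= W * (c + E).+1 ^ n)%N.
  rewrite -(@leq_pmul2l 'C(c + E + n, n)); last by rewrite bin_gt0 leq_addl.
  have := bin_shift_le n c E; rewrite -(@leq_pmul2l W.+1) // => b1.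
  rewrite mulnCA; apply: leq_trans b1 _.
  rewrite mulnA [X in (_ <= X)%N]mulnA [X in (_ <= X * _)%N]mulnC leq_mul2r; apply/orP; right.
  by apply: leq_trans (h E); rewrite leq_mul2r WM orbT.
case: c h h2 => [|c] h h2.
  by have := h2 0%N; rewrite add0n leq_pmul2r ?expn_gt0 // ltnn.
(* Taking [E.+1 = c.+1 * K] turns the inequality into [W.+1 * K ^ n <= W * K.+1 ^ n], which
   Bernoulli's inequality refutes as soon as [K >= n * W.+1]. *)
pose K := (n * W.+1).+1.
have := h2 (c.+1 * K).-1.
have -> : (c.+1 * K).-1.+1 = (c.+1 * K)%N by rewrite prednK.
have -> : (c.+1 + (c.+1 * K).-1).+1 = (c.+1 * K.+1)%N.
  by rewrite -addnS prednK // mulnS.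
rewrite !expnMn mulnCA [X in (_ <= X)%N]mulnCA leq_pmul2l ?expn_gt0 // => b1.
have b2 := bernoulli_nat K n.
have : (W.+1 * ((K.+1 - n) * K.+1 ^ n) <= W * K.+1 ^ n * K.+1)%N.
  apply: leq_trans (_ : W.+1 * (K ^ n * K.+1) <= _)%N; first by rewrite leq_mul2l b2 orbT.
  by rewrite mulnA leq_mul2r b1 orbT.
rewrite mulnA -mulnA [X in (_ <= X)%N]mulnAC mulnA leq_pmul2r ?expn_gt0 //.
rewrite /K; nia.
Qed.

Lemma ord_emb (n s : nat) (A : {set 'I_n}) : #|A| = s ->
  exists2 e : 'I_s -> 'I_n, injective e & forall i, e i \in A.
Proof. by move=> <-; exists enum_val; [exact: enum_val_inj | exact: enum_valP]. Qed.

(** * Independent families modulo an ideal *)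

Section Hilbert.
Variables (k : fieldType) (n : nat).
Local Notation R := {mpoly k[n]}.
Implicit Types (I J P Q : polyset k n) (f g u v : R).

(** States that [(R/I)_D] has dimension at least [r], by witnesses in [R] instead of a quotient
    space; [msize] of a nonzero polynomial is its degree plus one. *)
Definition hasindep I (D r : nat) :=
  exists v : 'I_r -> R, (forall i, (msize (v i) <= D.+1)%N) /\
    (forall c : 'I_r -> k, I (\sum_i c i *: v i) -> forall i, c i = 0).

Lemma hasindep_fin I D (T : finType) (v : T -> R) :
  (forall i, (msize (v i) <= D.+1)%N) ->
  (forall c : T -> k, I (\sum_i c i *: v i) -> forall i, c i = 0) ->
  hasindep I D #|T|.
Proof.
move=> hs hv; exists (v \o enum_val); split => [i|c hc i]; first exact: hs.
have := hv (c \o enum_rank).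
rewrite (reindex (fun i : 'I_#|T| => enum_val i)) /=; last first.
  by apply: onW_bij; apply: enum_val_bij.
under eq_bigr do rewrite enum_valK.
by move=> /(_ hc (enum_val i)); rewrite enum_valK.
Qed.

Lemma card_bmultinom D : (#|{: 'X_{1..n < D.+1}}| <= 'C(n + D, n))%N.
Proof.
rewrite -card_partial_ord_partitions.
pose F (m : 'X_{1..n < D.+1}) : n.-tuple 'I_D.+1 := [tuple inord (m i) | i < n].
have hm (m : 'X_{1..n < D.+1}) i : (m i < D.+1)%N.
  apply: leq_ltn_trans (bmdeg m); rewrite mdegE (bigD1 i) //=; exact: leq_addr.
have injF : injective F.
  move=> m1 m2 e; apply/val_inj/mnmP => i.
  by have := congr1 (fun t => val (tnth t i)) e; rewrite /F !tnth_mktuple /= !inordK.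
rewrite -(card_imset _ injF) subset_leq_card //.
apply/subsetP => t /imsetP[m _ ->]; rewrite inE big_tuple.
under eq_bigr do rewrite tnth_mktuple inordK //.
by rewrite -mdegE -ltnS bmdeg.
Qed.

Lemma hasindep_bound I D r : I 0 -> hasindep I D r -> (r <= 'C(n + D, n))%N.
Proof.
move=> I0 [v [hs hv]]; apply: leq_trans (card_bmultinom D).
pose A : 'M[k]_(r, #|{: 'X_{1..n < D.+1}}|) := \matrix_(i, b) (v i)@_(enum_val b : 'X_{1..n < D.+1}).
suff fA : row_free A by rewrite -(eqP fA) rank_leq_col.
apply/inj_row_free => w wA.
suff e0 : \sum_i w 0 i *: v i = 0.
  by apply/rowP => i; rewrite mxE; apply: hv; rewrite e0.
apply/mpolyP => m; rewrite mcoeff0 raddf_sum /=.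
case: (ltnP (mdeg m) D.+1) => mD; last first.
  rewrite big1 // => i _; rewrite mcoeffZ memN_msupp_eq0 ?mulr0 //.
  by apply: msize_mdeg_ge; apply: leq_trans (hs i) mD.
have /rowP /(_ (enum_rank (BMultinom mD))) := wA.
rewrite !mxE => e; rewrite -[RHS]e.
by apply: eq_bigr => i _; rewrite mcoeffZ mxE enum_rankK.
Qed.

Lemma hasindep_sub I J D r : subset_ideal I J -> hasindep J D r -> hasindep I D r.
Proof. by move=> IJ [v [hs hv]]; exists v; split=> // c /IJ /hv. Qed.

(** [J] may be larger than the ideal generated by [I] and [f], which allows intersections of primes
    at every stage; the dimension inequality survives. *)
Definition ladder_step d I J f :=
  [/\ subset_ideal I J, J f, (forall g, I (f * g) -> I g) & (msize f <= d.+1)%N].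

Lemma msizeM_leq f g a b : (msize f <= a.+1)%N -> (msize g <= b.+1)%N ->
  (msize (f * g) <= (a + b).+1)%N.
Proof.
move=> hf hg; have [->|f0] := eqVneq f 0; first by rewrite mul0r msize0.
have [->|g0] := eqVneq g 0; first by rewrite mulr0 msize0.
rewrite msizeM //; move: hf hg; move: (msize f) (msize g) => x y; lia.
Qed.

(** The family for [J] and the multiples by [f] of the family for [I] are jointly independent modulo
    [I]: modulo [J] the multiples vanish, which kills the first coefficients, and then [f] can be
    cancelled modulo [I]. *)
Lemma hasindep_step d I J f D r r' : is_ideal J -> ladder_step d I J f -> (d <= D)%N ->
  hasindep J D r -> hasindep I (D - d) r' -> hasindep I D (r + r').
Proof.
move=> idJ [IJ Jf nzd sf] dD [v [vs hv]] [w [ws hw]].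
have -> : (r + r' = #|{: 'I_r + 'I_r'}|)%N by rewrite card_sum !card_ord.
apply: (@hasindep_fin _ _ _ (fun x => match x with inl i => v i | inr i => f * w i end)).
  case=> i; first exact: vs.
  by rewrite -[D](subnKC dD); apply: msizeM_leq.
move=> c; rewrite big_sumType /= => hI.
have e : \sum_i c (inr i) *: (f * w i) = f * \sum_i c (inr i) *: w i.
  by rewrite mulr_sumr; apply: eq_bigr => i _; rewrite scalerAr.
rewrite e in hI.
have c1 : forall i, c (inl i) = 0.
  apply: hv; apply: (idealDr idJ _ (IJ _ hI)).
  exact: idealMr.
rewrite big1 ?add0r in hI; last by move=> i _; rewrite c1 scale0r.
by case=> i; [apply: c1 | apply: (hw (c \o inr)); apply: nzd].
Qed.

(** The dimension is at least [a / w]; the weight [w] collects powers of [d] without division. *)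
Definition weighted I D a w := exists2 e, hasindep I D e & (a <= w * e)%N.

Lemma psum_split r d D : {homo r : a b / (a <= b)%N} -> (0 < d <= D)%N ->
  (psum r D <= psum r (D - d) + d * r D)%N.
Proof.
move=> hr /andP[d0 dD]; have e : (D.+1 = (D - d).+1 + d)%N by lia.
rewrite /psum e big_split_ord /= leq_add2l.
rewrite -[X in (_ <= X * _)%N]card_ord -sum_nat_const; apply: leq_sum => j _.
by apply: hr; have := ltn_ord j; lia.
Qed.

(** Unrolling the inequality of [hasindep_step] samples the monotone bound [r] at every [d]-th
    degree down from [D]; each sample, taken [d] times, dominates [d] consecutive terms of the
    sum. *)
Lemma weighted_stage d I J f w r : is_ideal J -> ladder_step d I J f -> (0 < d)%N ->
  {homo r : a b / (a <= b)%N} -> (forall D, weighted J D (r D) w) ->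
  forall D, weighted I D (psum r D) (w * d).
Proof.
move=> idJ st d0 hr hJ D; elim/ltn_ind: D => D IH.
case: (hJ D) => e he le; case: (leqP d D) => dD.
  case: (IH (D - d)%N) => [|e' he' le']; first lia.
  exists (e + e')%N; first exact: hasindep_step st dD he he'.
  have := psum_split hr (introT andP (conj d0 dD)); nia.
exists e; first by case: st => s _ _ _; apply: hasindep_sub s he.
have : (psum r D <= D.+1 * r D)%N.
  rewrite /psum -[X in (_ <= X * _)%N]card_ord -sum_nat_const; apply: leq_sum => j _.
  by apply: hr; rewrite -ltnS.
nia.
Qed.

Lemma weighted_iter d (J : nat -> polyset k n) (f : nat -> R) h : (0 < d)%N ->
  (forall l, (l <= h)%N -> is_ideal (J l)) ->
  (forall l, (l < h)%N -> ladder_step d (J l) (J l.+1) (f l)) ->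
  forall r w, {homo r : a b / (a <= b)%N} -> (forall D, weighted (J h) D (r D) w) ->
  forall D, weighted (J 0%N) D (iter h psum r D) (w * d ^ h).
Proof.
move=> d0; elim: h => [|h IH] idJ st r w hr hw D; first by rewrite muln1; apply: hw.
rewrite iterSr expnS mulnA; apply: IH.
- by move=> l lh; apply: idJ; apply: leqW.
- by move=> l lh; apply: st; apply: leqW.
- exact: psum_mono.
- apply: (@weighted_stage _ _ (J h.+1) (f h)) => //; [exact: idJ | exact: st].
Qed.

(** Going down [h] steps turns growth like [M] copies of a polynomial ring in [s] variables into
    growth of degree [s + h], with leading term divided by [d ^ h]. This cannot exceed the growth of
    [R]. *)
Lemma ladder_bound d (J : nat -> polyset k n) (f : nat -> R) h M c s :
  (0 < d)%N -> (0 < M)%N ->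
  (forall l, (l <= h)%N -> is_ideal (J l)) ->
  (forall l, (l < h)%N -> ladder_step d (J l) (J l.+1) (f l)) ->
  (forall E, hasindep (J h) (c + E) (M * 'C(E + s, s))) ->
  (s + h <= n)%N /\ (s + h = n -> (M <= d ^ h)%N)%N.
Proof.
move=> d0 M0 idJ st hh.
have hw D : weighted (J h) D (shifted_bin M c s D) 1.
  rewrite /shifted_bin; case: (leqP c D) => cD.
    exists (M * 'C(D - c + s, s))%N; last by rewrite mul1n.
    by rewrite -{1}(subnKC cD); apply: hh.
  exists 0%N => //; exists (fun=> 0); split; first by case.
  by move=> ? _ [].
apply: (@bin_growth _ _ c) => // E.
case: (weighted_iter d0 idJ st (@shifted_bin_mono M c s) hw (c + E)%N) => e he.
rewrite iter_psum_shifted_bin /shifted_bin leq_addr addKn mul1n => /leq_trans; apply.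
rewrite leq_mul2l; apply/orP; right.
have := hasindep_bound (ideal0 (idJ _ (leq0n h))) he; by rewrite addnC.
Qed.

(** * Independent variables modulo a prime *)

Section Monomials.
Variables (s : nat) (e : 'I_s -> 'I_n).
Hypothesis inj_e : injective e.

Definition expmon (t : 'I_s -> nat) : 'X_{1..n} := (\sum_(i < s) U_(e i) *+ t i)%MM.

Lemma expmonE t i : expmon t (e i) = t i.
Proof.
rewrite /expmon mnm_sumE (bigD1 i) //= big1 => [|l li].
  by rewrite mulmnE mnm1E eqxx mul1n addn0.
by rewrite mulmnE mnm1E (inj_eq inj_e) (negPf li).
Qed.

Lemma expmon_out t j : (forall i, e i != j) -> expmon t j = 0%N.
Proof.
by move=> h; rewrite /expmon mnm_sumE big1 // => i _; rewrite mulmnE mnm1E (negPf (h i)).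
Qed.

Lemma expmon_inj t1 t2 : expmon t1 = expmon t2 -> t1 =1 t2.
Proof. by move=> h i; rewrite -!expmonE h. Qed.

Lemma mdeg_expmon t : mdeg (expmon t) = (\sum_(i < s) t i)%N.
Proof. by rewrite mdeg_sum; apply: eq_bigr => i _; rewrite mdegMn mdeg1 mul1n. Qed.
End Monomials.

End Hilbert.

(** * Transcendence bases and the height of a prime *)

Section Dimension.
Variables (k : fieldType) (n : nat).
Hypothesis char0 : [pchar k] =i pred0.
Local Notation R := {mpoly k[n]}.
Implicit Types (I J P Q : polyset k n) (f g u v : R) (A B : {set 'I_n}).

(* Polynomials in the variables indexed by [A]; this reading of the definition uses
   characteristic zero. *)
Definition vars_in A f := forall j, j \notin A -> f^`M(j) = 0.

Lemma vars_inC A c : vars_in A c%:MP.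
Proof. by move=> j _; rewrite mderivC. Qed.
Lemma vars_in1 A : vars_in A 1.
Proof. by rewrite -mpolyC1; apply: vars_inC. Qed.
Lemma vars_in0 A : vars_in A 0.
Proof. by rewrite -mpolyC0; apply: vars_inC. Qed.
Lemma vars_inX A i : i \in A -> vars_in A 'X_i.
Proof.
move=> iA j jA; rewrite mderivX mnm1E; case: eqP => [e|_]; last by rewrite scale0r.
by rewrite e (negPf jA) in iA.
Qed.
Lemma vars_inD A f g : vars_in A f -> vars_in A g -> vars_in A (f + g).
Proof. by move=> hf hg j jA; rewrite mderivD hf // hg // addr0. Qed.
Lemma vars_inN A f : vars_in A f -> vars_in A (- f).
Proof. by move=> hf j jA; rewrite mderivN hf // oppr0. Qed.
Lemma vars_inM A f g : vars_in A f -> vars_in A g -> vars_in A (f * g).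
Proof. by move=> hf hg j jA; rewrite mderivM hf // hg // mul0r mulr0 addr0. Qed.
Lemma vars_inZ A c f : vars_in A f -> vars_in A (c *: f).
Proof. by move=> hf j jA; rewrite mderivZ hf // scaler0. Qed.
Lemma vars_in_sum A (T : Type) (r : seq T) (p : pred T) (F : T -> R) :
  (forall i, p i -> vars_in A (F i)) -> vars_in A (\sum_(i <- r | p i) F i).
Proof. by move=> h; apply: big_ind => //; [apply: vars_in0 | apply: vars_inD]. Qed.
Lemma vars_in_prod A (T : Type) (r : seq T) (p : pred T) (F : T -> R) :
  (forall i, p i -> vars_in A (F i)) -> vars_in A (\prod_(i <- r | p i) F i).
Proof. by move=> h; apply: big_ind => //; [apply: vars_in1 | apply: vars_inM]. Qed.
Lemma vars_in_exp A f a : vars_in A f -> vars_in A (f ^+ a).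
Proof. by move=> h; elim: a => [|a IH]; [apply: vars_in1 | rewrite exprS; apply: vars_inM]. Qed.
Lemma vars_in_kspace A : kspace (vars_in A).
Proof. by split; [apply: vars_in0 | apply: vars_inD | move=> *; apply: vars_inZ]. Qed.

Lemma vars_in_set0 f : vars_in set0 f -> f = (f@_0%MM)%:MP.
Proof.
move=> h; apply/mpolyP => m; rewrite mcoeffC; case: eqP => [->|/eqP m0]; first by rewrite mulr1.
rewrite mulr0; have /existsP [i mi] : [exists i, m i != 0%N].
  apply: contraR m0; rewrite negb_exists => /forallP h0.
  by apply/eqP/mnmP => i; rewrite mnm0E; apply/eqP; rewrite -[_ == _]negbK h0.
by apply: mderiv0_mcoeff mi => //; apply: h; rewrite inE.
Qed.

Lemma vars_in_spec A j c f : vars_in (j |: A) f -> vars_in A (spec j c f).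
Proof.
move=> h i iA; have [->|ij] := eqVneq i j; first exact: mderiv_spec_self.
by apply: mderiv_spec => //; apply: h; rewrite !inE negb_or ij.
Qed.

Lemma vars_in_unipoly A j f a : vars_in (j |: A) f -> vars_in A (unipoly j f)`_a.
Proof.
move=> h; apply: (interpolation_all char0 (vars_in_kspace A)) => c.
by rewrite unipoly_horner_spec; apply: vars_in_spec.
Qed.

Definition algindep P A := forall f, vars_in A f -> P f -> f = 0.

(** A set of largest size works: adding [j] breaks independence, and the failure is the wanted
    relation. So [A] is a transcendence basis modulo [P]. *)
Lemma max_algindep P : is_prime_ideal P -> exists2 A, algindep P A &
  forall j, j \notin A -> exists f, [/\ f != 0, vars_in (j |: A) f & P f].
Proof.
move=> prP; have h0 : asb (algindep P set0).
  apply/asbP => f /vars_in_set0 -> /(prime_const prP) ->; exact: mpolyC0.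
case: (@arg_maxnP _ set0 (fun A => asb (algindep P A)) (fun A => #|A|) h0) => A /asbP hA mA.
exists A => // j jA; apply: NNPP => hn.
have /mA : asb (algindep P (j |: A)).
  apply/asbP => f fv fP; apply/eqP; apply: NNPP => /negP f0.
  by apply: hn; exists f.
by rewrite /geq /= cardsU1 jA add1n ltnn.
Qed.

(** The members are [g j] times a monomial of degree at most [E] in the variables of [A j], where
    [g j] lies in every [q l] with [l != j] but not in [q j]. Modulo [q j] only block [j] survives,
    and there [g j] cancels. The constant [c] bounds the degrees of the [g j]. *)
Lemma hasindep_primes M (q : 'I_M -> polyset k n) (A : 'I_M -> {set 'I_n}) s :
  (forall j, is_prime_ideal (q j)) -> (forall j, algindep (q j) (A j)) ->
  (forall j, #|A j| = s) -> (forall j l, j != l -> exists2 g, q l g & ~ q j g) ->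
  exists c, forall E, hasindep (fun f => forall j, q j f) (c + E) (M * 'C(E + s, s)).
Proof.
move=> prq aiq sA hg.
have [G hG] : exists G : 'I_M -> 'I_M -> R, forall j l, j != l -> q l (G j l) /\ ~ q j (G j l).
  apply: (fin_all_exists (P := fun j F => forall l, j != l -> q l (F l) /\ ~ q j (F l))) => j.
  apply: (fin_all_exists (P := fun l g => j != l -> q l g /\ ~ q j g)) => l.
  have [->|jl] := eqVneq j l; first by exists 0.
  by case: (hg _ _ jl) => g; exists g.
have [e inj_e eA] := fin_all_exists2 (fun j => ord_emb (sA j)).
pose g j := \prod_(l | j != l) G j l.
have gq j l : j != l -> q l (g j).
  move=> jl; rewrite /g (bigD1 l) //=; apply: idealMr; first exact: prime_ideal.
  by case: (hG _ _ jl).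
have gNq j : ~ q j (g j) by apply: prime_prod => // l /hG [].
pose c := (\max_j msize (g j))%N; exists c => E.
pose T := {t : s.-tuple 'I_E.+1 | (\sum_(i <- t) i <= E)%N}.
have -> : (M * 'C(E + s, s) = #|{: 'I_M * T}|)%N.
  rewrite card_prod card_ord card_sig addnC -card_partial_ord_partitions; congr (_ * _)%N.
  by apply: eq_card => t; rewrite inE.
pose X (j : 'I_M) (t : T) : R := 'X_[expmon (e j) (tnth (val t))].
apply: (@hasindep_fin _ _ _ _ _ (fun p => g p.1 * X p.1 p.2)) => [[j t]|C] /=.
  apply: msizeM_leq.
    by apply: leqW; rewrite /c (bigD1 j) //= leq_maxl.
  by rewrite msizeX mdeg_expmon ltnS -(big_tuple _ _ _ xpredT (fun i : 'I_E.+1 => val i)) (valP t).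
move=> hC [j0 t0]; move: (hC j0).
have -> : \sum_p C p *: (g p.1 * X p.1 p.2) = \sum_j \sum_t C (j, t) *: (g j * X j t).
  by rewrite pair_bigA; apply: eq_bigr => -[].
rewrite (bigD1 j0) //=.
have idq := prime_ideal (prq j0).
have hrest : q j0 (\sum_(j | j != j0) \sum_t C (j, t) *: (g j * X j t)).
  apply: ideal_sum => // j jj0; apply: ideal_sum => // t _.
  by apply: idealZ => //; apply: idealMr => //; apply: gq.
move=> /(idealDr idq hrest).
have -> : \sum_(t : T) C (j0, t) *: (g j0 * X j0 t) = g j0 * \sum_t C (j0, t) *: X j0 t.
  by rewrite mulr_sumr; apply: eq_bigr => t _; rewrite scalerAr.
move=> /(primeM (prq j0)) [/gNq //|h0].
have /(congr1 (mcoeff (expmon (e j0) (tnth (val t0))))) : \sum_t C (j0, t) *: X j0 t = 0.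
  apply: (aiq j0) h0; apply: vars_in_sum => t _; apply: vars_inZ.
  rewrite /X /expmon -mprodXnE; apply: vars_in_prod => i _.
  by apply: vars_in_exp; apply: vars_inX; apply: eA.
rewrite mcoeff0 raddf_sum (bigD1 t0) //= mcoeffZ mcoeffX eqxx mulr1 big1 ?addr0 // => t tt0.
rewrite mcoeffZ mcoeffX; case: eqP => [/(expmon_inj (inj_e j0)) ett0|]; last by rewrite mulr0.
move/eqP: tt0; case; apply/val_inj/eq_from_tnth => i; apply: val_inj; exact: ett0.
Qed.

Lemma hasindep_algindep P A : is_prime_ideal P -> algindep P A ->
  exists c, forall E, hasindep P (c + E) (1 * 'C(E + #|A|, #|A|)).
Proof.
move=> prP aiP.
case: (@hasindep_primes 1 (fun=> P) (fun=> A) #|A|) => // [j l|c hc].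
  by rewrite !ord1.
by exists c => E; apply: hasindep_sub (hc E) => f Pf _.
Qed.

(** A chain of primes is itself a ladder: an element of the next prime outside the current one is a
    nonzerodivisor modulo the current one. *)
Lemma chain_algindep_bound P A h : prime_chain_to P h -> algindep P A -> (#|A| + h <= n)%N.
Proof.
move=> [c [pc sc <-]] aiP.
have [f hf] : exists f : 'I_h -> R, forall i : 'I_h, c i.+1 (f i) /\ ~ c i (f i).
  by apply: (fin_all_exists (P := fun (i : 'I_h) g => c i.+1 g /\ ~ c i g)) => i; case: (sc i).
pose fn i : R := if insub i is Some j then f j else 0.
have hfn i : (i < h)%N -> c i.+1 (fn i) /\ ~ c i (fn i).
  by move=> ih; rewrite /fn insubT; exact: (hf (Ordinal ih)).
pose d := (\max_(i < h) msize (fn i)).+1.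
case: (hasindep_algindep (pc h (leqnn h)) aiP) => b hb.
suff [] : (#|A| + h <= n)%N /\ ((#|A| + h)%N = n -> (1 <= d ^ h)%N) by [].
apply: (@ladder_bound k n d c fn h 1 b) => //.
  by move=> l lh; apply: prime_ideal; apply: pc.
move=> l lh; case: (hfn l lh) => h1 h2; split=> //.
- by case: (sc l lh).
- by move=> g /(primeM (pc l (ltnW lh))) [].
- by do 2!apply: leqW; rewrite (bigD1 (Ordinal lh)) //= leq_maxl.
Qed.

(* The extension of the contraction of [Q] to the polynomials not involving variable [j]. *)
Definition elim_var (j : 'I_n) Q : polyset k n := fun f => forall c, Q (spec j c f).

Lemma horner_ideal I (F : {poly R}) x : is_ideal I -> (forall a, I F`_a) -> I F.[x].
Proof.
by move=> idI h; rewrite horner_coef; apply: ideal_sum => // i _; apply: idealMr.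
Qed.

Lemma elim_var_coef j Q f : is_ideal Q -> elim_var j Q f -> forall a, Q (unipoly j f)`_a.
Proof.
move=> idQ h; apply: (interpolation_all char0 (ideal_kspace idQ)) => c.
by rewrite unipoly_horner_spec.
Qed.

Lemma elim_var_sub j Q : is_ideal Q -> subset_ideal (elim_var j Q) Q.
Proof.
move=> idQ f /(elim_var_coef idQ) h.
by rewrite -(unipoly_hornerX j f); apply: horner_ideal.
Qed.

Lemma elim_var_keep j Q f : f^`M(j) = 0 -> Q f -> elim_var j Q f.
Proof. by move=> df Qf c; rewrite spec_id. Qed.

(** If [f] and [g] lie outside, each has a coefficient outside [Q], and a single constant
    specialises both to values outside [Q]; this contradicts primality of [Q]. *)
Lemma elim_var_prime j Q : is_prime_ideal Q -> is_prime_ideal (elim_var j Q).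
Proof.
move=> prQ; have idQ := prime_ideal prQ; split.
- split=> [c|f g hf hg c|r f hf c]; rewrite ?(rmorph0, rmorphD, rmorphM).
  + exact: ideal0.
  + exact: idealD (hf c) (hg c).
  + exact: idealM (hf c).
- by move=> /(_ 0); rewrite rmorph1; apply: prime_N1.
- move=> f g hfg; apply: NNPP => /not_or_and [hf hg].
  have ex h : ~ elim_var j Q h -> exists a, ~ Q (unipoly j h)`_a.
    move=> hn; apply: not_all_ex_not => ha; apply: hn => c.
    by rewrite -unipoly_horner_spec; apply: horner_ideal.
  pose F (b : bool) := unipoly j (if b then f else g).
  have [||c hc] := @avoid _ char0 n bool (fun=> Q) F.
  + by move=> _; apply: ideal_kspace.
  + by case; apply: ex.
  have := hfg c; rewrite rmorphM /= => /(primeM prQ).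
  by rewrite -!unipoly_horner_spec => -[/(hc true)|/(hc false)].
Qed.

Definition elim_vars P (js : seq 'I_n) := foldl (fun Q j => elim_var j Q) P js.

Lemma elim_vars_prime P js : is_prime_ideal P -> is_prime_ideal (elim_vars P js).
Proof. by elim: js P => //= j js IH P prP; apply: IH; apply: elim_var_prime. Qed.

Lemma elim_vars_sub P js : is_prime_ideal P -> subset_ideal (elim_vars P js) P.
Proof.
elim: js P => [|j js IH] P prP //= f h.
apply: (@elim_var_sub j); first exact: prime_ideal.
by apply: IH h; apply: elim_var_prime.
Qed.

Lemma elim_vars_keep P js f : (forall j, j \in js -> f^`M(j) = 0) -> P f -> elim_vars P js f.
Proof.
elim: js P => [|j js IH] P //= h Pf; apply: IH.
  by move=> i ijs; apply: h; rewrite inE ijs orbT.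
by apply: elim_var_keep => //; apply: h; rewrite mem_head.
Qed.

(** The variables outside [A] are eliminated one after another. At [j] the inclusion is strict: the
    relation of [j] over [A] survives the earlier eliminations, but if it survived that of [j], its
    coefficients would lie in [P] and vanish by independence. *)
Lemma algindep_chain P A : is_prime_ideal P -> algindep P A ->
  (forall j, j \notin A -> exists f, [/\ f != 0, vars_in (j |: A) f & P f]) ->
  prime_chain_to P (n - #|A|).
Proof.
move=> prP aiP algP; pose js := enum (~: A).
have sz : size js = (n - #|A|)%N by rewrite -cardE cardsCs setCK card_ord.
have ujs : uniq js := enum_uniq _.
(* The chain has to increase, so fewer variables are eliminated as the index grows; at the top none
   is, which leaves [P]. *)
rewrite -sz; exists (fun i => elim_vars P (take (size js - i) js)); split.
- by move=> i _; apply: elim_vars_prime.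
- move=> i ih; set l := (size js - i.+1)%N.
  have -> : (size js - i = l.+1)%N by rewrite /l; lia.
  have lh : (l < size js)%N by rewrite /l; lia.
  pose j := tnth (in_tuple js) (Ordinal lh).
  have jE : j = nth j js l by rewrite {1}/j (tnth_nth j).
  have jA : j \notin A.
    by have : j \in js by [rewrite jE mem_nth]; rewrite mem_enum inE.
  rewrite (take_nth j lh) -jE /elim_vars foldl_rcons -!/(elim_vars _ _).
  have prQ := elim_vars_prime (take l js) prP.
  split; first by apply: elim_var_sub; apply: prime_ideal.
  case: (algP j jA) => f [f0 vf Pf]; exists f; split.
    apply: elim_vars_keep => // a ajs; apply: vf.
    rewrite !inE negb_or; apply/andP; split.
      apply: contraTneq ajs => ->.
      have := ujs; rewrite -{1}(cat_take_drop l js) cat_uniq => /and3P[_ /hasPn hd _].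
      apply: hd; rewrite jE; rewrite -[l in nth _ _ l]addn0 -nth_drop mem_nth //.
      by rewrite size_drop subn_gt0.
    by have := mem_take ajs; rewrite mem_enum inE.
  move=> hE; move/eqP: f0; apply.
  rewrite -(unipoly_hornerX j f); apply: (@horner_ideal (fun h => h = 0)).
    by split=> // [? ? -> ->|r ? ->]; rewrite ?addr0 ?mulr0.
  move=> a; apply: aiP; first exact: vars_in_unipoly.
  by apply: elim_vars_sub (elim_var_coef (prime_ideal prQ) hE a).
- by rewrite subnn take0.
Qed.

Lemma prime_height P : is_prime_ideal P -> exists A, [/\ algindep P A,
  (forall j, j \notin A -> exists f, [/\ f != 0, vars_in (j |: A) f & P f]) &
  has_height P (n - #|A|)].
Proof.
move=> prP; case: (max_algindep prP) => A aiA alA; exists A; split=> //; split.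
  exact: algindep_chain.
by move=> h' ch; have := chain_algindep_bound ch aiA; lia.
Qed.

Lemma has_height_uniq P h h' : has_height P h -> has_height P h' -> h = h'.
Proof. by move=> [c1 m1] [c2 m2]; apply/eqP; rewrite eqn_leq m1 // m2. Qed.

Lemma height_algindep P h : is_prime_ideal P -> has_height P h ->
  exists A, [/\ algindep P A,
  (forall j, j \notin A -> exists f, [/\ f != 0, vars_in (j |: A) f & P f]) &
  (#|A| + h)%N = n].
Proof.
move=> prP hP; case: (prime_height prP) => A [h1 h2 h3]; exists A; split=> //.
rewrite (has_height_uniq hP h3) subnKC //.
by rewrite -[X in (_ <= X)%N]card_ord max_card.
Qed.

Lemma height_leq_nvars P h : is_prime_ideal P -> has_height P h -> (h <= n)%N.
Proof. by move=> prP /(height_algindep prP) [A [_ _ <-]]; apply: leq_addl. Qed.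

Lemma prime_chain_extend P Q h : is_prime_ideal Q -> strict_subset_ideal P Q ->
  prime_chain_to P h -> prime_chain_to Q h.+1.
Proof.
move=> prQ sPQ [c [pc sc ch]]; exists (fun i => if i == h.+1 then Q else c i); split.
- by move=> i ih; case: eqP => // /eqP ne; apply: pc; lia.
- move=> i; rewrite ltnS => ih; rewrite eqSS.
  have -> : (i == h.+1) = false by lia.
  by case: eqP => [->|ne]; [rewrite ch | apply: sc; lia].
- by rewrite eqxx.
Qed.

Lemma same_height_eq P Q h h' : is_prime_ideal Q -> subset_ideal P Q ->
  has_height P h -> has_height Q h' -> (h' <= h)%N -> subset_ideal Q P.
Proof.
move=> prQ PQ [cP _] [_ mQ] hh f Qf; apply: NNPP => Pf.
have /mQ : prime_chain_to Q h.+1.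
  by apply: (prime_chain_extend prQ _ cP); split=> //; exists f.
lia.
Qed.

End Dimension.

(** * Noetherianity *)

(** Choose successively positions at which [g] attains the least value of the remaining tail. *)
Lemma mono_subseq (g : nat -> nat) : exists phi : nat -> nat,
  (forall i, phi i < phi i.+1)%N /\ (forall i, g (phi i) <= g (phi i.+1))%N.
Proof.
have hm i : exists j, (i <= j)%N /\ forall l, (i <= l)%N -> (g j <= g l)%N.
  have ex : exists v, asb (exists2 j, (i <= j)%N & g j = v).
    by exists (g i); apply/asbP; exists i.
  case: (ex_minnP ex) => v /asbP [j ij gj] mv; exists j; split=> // l il.
  by rewrite gj; apply: mv; apply/asbP; exists l.
pose mi i := proj1_sig (constructive_indefinite_description _ (hm i)).
have miP i : (i <= mi i)%N /\ forall l, (i <= l)%N -> (g (mi i) <= g l)%N.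
  exact: (proj2_sig (constructive_indefinite_description _ (hm i))).
pose phi := fix phi i := if i is i'.+1 then mi (phi i').+1 else mi 0%N.
have lt i : (phi i < phi i.+1)%N by rewrite /=; case: (miP (phi i).+1).
exists phi; split=> // i; case: i => [|i].
  by have [_] := miP 0%N; apply.
by have [h] := miP (phi i).+1; apply; apply: leq_trans (ltnW (lt i.+1)).
Qed.

Lemma mono_subseq_all (gs : seq (nat -> nat)) : exists phi : nat -> nat,
  (forall i, phi i < phi i.+1)%N /\
  (forall a i, (a < size gs)%N ->
     nth id gs a (phi i) <= nth id gs a (phi i.+1))%N.
Proof.
elim: gs => [|g gs [phi [h1 h2]]]; first by exists id.
have [psi [k1 k2]] := mono_subseq (g \o phi).
have hphi : {homo phi : a b / (a < b)%N}.
  by apply: (homo_ltn (r := fun a b => (a < b)%N)) => [b a c|//]; apply: ltn_trans.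
exists (phi \o psi); split=> [i|[|a] i] /=; last 2 first.
- by move=> _; apply: k2.
- rewrite ltnS => ha; pose f b := nth id gs a (phi b).
  have hf : {homo f : b c / (b <= c)%N}.
    by apply: homo_leq => // [b c d|b]; [apply: leq_trans | apply: h2].
  exact: hf (ltnW (k1 i)).
- exact: hphi.
Qed.

Lemma dickson n (F : nat -> 'X_{1..n}) : exists i j, (i < j)%N /\ (F i <= F j)%MM.
Proof.
have [phi [h1 h2]] := mono_subseq_all [seq (fun b => F b a) | a <- enum 'I_n].
exists (phi 0%N), (phi 1%N); split; first exact: h1.
apply/mnm_lepP => a; have := h2 a 0%N.
by rewrite size_map size_enum_ord ltn_ord (nth_map a) ?size_enum_ord // nth_ord_enum; apply.
Qed.

Section Noetherian.
Variables (k : fieldType) (n : nat).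
Local Notation R := {mpoly k[n]}.
Implicit Types (I J P Q : polyset k n) (f g u v : R).

Definition gen r (u : 'I_r -> R) : polyset k n := fun f => exists c, f = \sum_i c i * u i.

Lemma gen_ideal r (u : 'I_r -> R) : is_ideal (gen u).
Proof.
split.
- by exists (fun=> 0); rewrite big1 // => i _; rewrite mul0r.
- move=> f g [c ->] [d ->]; exists (fun i => c i + d i); rewrite -big_split.
  by apply: eq_bigr => i _; rewrite mulrDl.
- move=> a f [c ->]; exists (fun i => a * c i); rewrite mulr_sumr.
  by apply: eq_bigr => i _; rewrite mulrA.
Qed.

Lemma gen_mem r (u : 'I_r -> R) i : gen u (u i).
Proof.
exists (fun j => (j == i)%:R); rewrite (bigD1 i) //= eqxx mul1r big1 ?addr0 // => j ne.
by rewrite (negPf ne) mul0r.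
Qed.

Lemma gen_sub r (u : 'I_r -> R) I : is_ideal I -> (forall i, I (u i)) -> subset_ideal (gen u) I.
Proof. by move=> idI h f [c ->]; apply: ideal_sum => // i _; apply: idealM. Qed.

(** Division algorithm: subtracting a multiple of a suitable [g] cancels the leading term, and the
    leading monomial drops in a well-founded order. *)
Lemma mlead_division (s : seq R) I : is_ideal I ->
  (forall f, I f -> f != 0 ->
     exists2 g, g \in s & [/\ I g, g != 0 & (mlead g <= mlead f)%MM]) ->
  subset_ideal I (gen (tnth (in_tuple s))).
Proof.
move=> idI h; elim/mleadrect => f IH If.
have idG := gen_ideal (tnth (in_tuple s)).
have [->|f0] := eqVneq f 0; first exact: ideal0.
case: (h f If f0) => g gs [Ig g0 gf].
pose q := (mleadc f / mleadc g) *: ('X_[mlead f - mlead g] * g).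
have lf0 : mleadc f != 0 by rewrite mleadc_eq0.
have lg0 : mleadc g != 0 by rewrite mleadc_eq0.
have X0 : 'X_[mlead f - mlead g] != 0 :> R by rewrite -msize_poly_eq0 msizeX.
have lq : mlead q = mlead f.
  by rewrite mleadZ ?mulf_neq0 ?invr_eq0 // mleadM // mleadXm submK.
have Gq : gen (tnth (in_tuple s)) q.
  apply: idealZ => //; apply: idealM => //.
  by have /seq_tnthP [i ->] := gs; apply: gen_mem.
have cq : q@_(mlead f) = mleadc f.
  have := mleadcM 'X_[mlead f - mlead g] g.
  by rewrite mcoeffZ mleadXm submK // mcoeffX eqxx mul1r => ->; rewrite divfK.
have -> : f = (f - q) + q by rewrite subrK.
apply: idealD => //; have [->|fq0] := eqVneq (f - q) 0; first exact: ideal0.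
apply: IH; last first.
  by apply: idealB => //; apply: idealZ => //; apply: idealM.
rewrite lt_neqAle; apply/andP; split; last first.
  by apply: le_trans (mleadB_le _ _) _; rewrite lq joinxx.
apply/eqP => e; move: fq0; rewrite -mleadc_eq0 e mcoeffB cq subrr eqxx; by [].
Qed.

(** Hilbert's basis theorem: otherwise elements of [I] could be chosen forever, none with leading
    monomial divisible by that of an earlier one, against Dickson's lemma. *)
Lemma ideal_fg I : is_ideal I ->
  exists r (u : 'I_r -> R), (forall i, I (u i)) /\ subset_ideal I (gen u).
Proof.
move=> idI; apply: NNPP => hn.
have step (s : seq R) : exists f, (forall g, g \in s -> I g) ->
    [/\ I f, f != 0 & forall g, g \in s -> g != 0 -> ~~ (mlead g <= mlead f)%MM].
  have [hs|hs] := classic (forall g, g \in s -> I g); last by exists 0.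
  apply: NNPP => hf; apply: hn; exists (size s), (tnth (in_tuple s)); split.
    by move=> i; apply: hs; rewrite mem_tnth.
  apply: mlead_division => // f If f0; apply: NNPP => hg; apply: hf.
  exists f => _; split=> // g gs g0.
  by apply/negP => gf; apply: hg; exists g => //; split=> //; apply: hs.
pose next s := proj1_sig (constructive_indefinite_description _ (step s)).
have nextP s : (forall g, g \in s -> I g) -> [/\ I (next s), next s != 0 &
    forall g, g \in s -> g != 0 -> ~~ (mlead g <= mlead (next s))%MM].
  exact: (proj2_sig (constructive_indefinite_description _ (step s))).
pose S := fix S i := if i is i'.+1 then next (S i') :: S i' else [::].
have SI i g : g \in S i -> I g.
  elim: i g => // i IH g /=; rewrite inE => /orP[/eqP->|/IH //].
  by case: (nextP (S i) IH).
have [i [j [ij lij]]] := dickson (fun i => mlead (next (S i))).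
have mS : next (S i) \in S j.
  elim: j ij {lij} => // j IH; rewrite ltnS leq_eqVlt /= inE => /orP[/eqP->|/IH->].
    by rewrite eqxx.
  by rewrite orbT.
case: (nextP (S j) (@SI j)) => _ _ /(_ _ mS).
by case: (nextP (S i) (@SI i)) => _ -> _ /(_ isT); rewrite lij.
Qed.

(** Without a maximal member, choice gives a strictly increasing sequence; its union is a finitely
    generated ideal, hence contained in one of the terms. *)
Lemma ideal_max (C : polyset k n -> Prop) I0 : (forall I, C I -> is_ideal I) -> C I0 ->
  exists I, C I /\ forall J, C J -> subset_ideal I J -> subset_ideal J I.
Proof.
move=> idC C0; apply: NNPP => hn.
have step I : exists J, C I -> C J /\ strict_subset_ideal I J.
  have [CI|nC] := classic (C I); last by exists I.
  apply: NNPP => hJ; apply: hn; exists I; split=> // J CJ IJ f Jf; apply: NNPP => If.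
  by apply: hJ; exists J => _; split=> //; split=> //; exists f.
pose next I := proj1_sig (constructive_indefinite_description _ (step I)).
have nextP I : C I -> C (next I) /\ strict_subset_ideal I (next I).
  exact: (proj2_sig (constructive_indefinite_description _ (step I))).
pose S := fix S i := if i is i'.+1 then next (S i') else I0.
have CS i : C (S i) by elim: i => //= i /nextP [].
have subS i j : (i <= j)%N -> subset_ideal (S i) (S j).
  elim: j => [|j IH]; first by rewrite leqn0 => /eqP ->.
  rewrite leq_eqVlt => /orP[/eqP-> //|/IH h] f /h; case: (nextP (S j) (CS j)) => _ [hs _].
  exact: hs.
pose U f := exists i, S i f.
have idU : is_ideal U.
  split; first by exists 0%N; apply: ideal0; apply: idC; apply: (CS 0%N).
    move=> f g [i hi] [j hj]; exists (maxn i j); apply: idealD; first exact: idC.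
      by apply: subS hi; apply: leq_maxl.
    by apply: subS hj; apply: leq_maxr.
  by move=> r f [i hi]; exists i; apply: idealM => //; apply: idC.
have [r [u [hu hU]]] := ideal_fg idU.
have [a ha] := fin_all_exists hu.
pose b := (\max_i a i)%N.
have Ub : subset_ideal U (S b).
  move=> f /hU; apply: gen_sub; first exact: idC.
  by move=> i; apply: subS (ha i); rewrite /b (bigD1 i) //= leq_maxl.
case: (nextP (S b) (CS b)) => _ [_ [f [hf []]]].
by apply: Ub; exists b.+1.
Qed.

(** * Powers of ideals *)

Inductive iprod I J : polyset k n :=
| iprod0 : iprod I J 0
| iprodS a b c : I a -> J b -> iprod I J c -> iprod I J (a * b + c).

Fixpoint ipow I N : polyset k n :=
  if N is N'.+1 then iprod I (ipow I N') else fun _ => True.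

Lemma iprod_ideal I J : is_ideal I -> is_ideal (iprod I J).
Proof.
move=> idI; split; first exact: iprod0.
  move=> f g hf hg; elim: hf => [|a b c Ia Jb _ IH]; first by rewrite add0r.
  by rewrite -addrA; apply: iprodS.
move=> r f; elim=> [|a b c Ia Jb _ IH]; first by rewrite mulr0; apply: iprod0.
by rewrite mulrDr mulrA; apply: iprodS => //; apply: idealM.
Qed.

Lemma iprodM I J a b : I a -> J b -> iprod I J (a * b).
Proof. by move=> Ia Jb; rewrite -[a * b]addr0; apply: iprodS => //; apply: iprod0. Qed.

Lemma ipow_ideal I N : is_ideal I -> is_ideal (ipow I N).
Proof. by case: N => [|N] idI; [split | apply: iprod_ideal]. Qed.

Lemma iprod_subr I J : is_ideal J -> subset_ideal (iprod I J) J.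
Proof.
move=> idJ f; elim=> [|a b c _ Jb _ IH]; first exact: ideal0.
by apply: idealD => //; apply: idealM.
Qed.

Lemma iprod_subl I J : is_ideal I -> subset_ideal (iprod I J) I.
Proof.
move=> idI f; elim=> [|a b c Ia _ _ IH]; first exact: ideal0.
by apply: idealD => //; apply: idealMr.
Qed.

Lemma ipow_leq I N N' : is_ideal I -> (N <= N')%N -> subset_ideal (ipow I N') (ipow I N).
Proof.
move=> idI; elim: N' => [|N' IH]; first by rewrite leqn0 => /eqP->.
rewrite leq_eqVlt => /orP[/eqP-> //|/IH h f hf]; apply: h.
by apply: iprod_subr hf; apply: ipow_ideal.
Qed.

Lemma ipow_exp I a N : is_ideal I -> I a -> ipow I N (a ^+ N).
Proof. by move=> idI Ia; elim: N => //= N IH; rewrite exprS; apply: iprodM. Qed.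

Lemma ipowM I N N' f g : is_ideal I -> ipow I N f -> ipow I N' g -> ipow I (N + N') (f * g).
Proof.
move=> idI; elim: N f => [|N IH] f /= hf hg.
  by apply: idealM => //; apply: ipow_ideal.
elim: hf => [|a b c Ia Jb _ IHc]; first by rewrite mul0r; apply: iprod0.
by rewrite mulrDl -mulrA; apply: iprodS => //; apply: IH.
Qed.

Lemma ipow_mderiv I N j f : is_ideal I -> ipow I N.+1 f -> ipow I N f^`M(j).
Proof.
move=> idI; elim: N f => // N IH f; have idN := ipow_ideal N.+1 idI.
elim=> [|a b c Ia Jb _ IHc]; first by rewrite mderiv0; apply: ideal0.
rewrite mderivD mderivM; apply: idealD => //; apply: idealD => //; first exact: idealM.
by apply: iprodM => //; apply: IH.
Qed.

Lemma ipow_nilpotent P Q r (u : 'I_r -> R) : is_ideal Q -> subset_ideal P (gen u) ->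
  (forall i, exists N, Q (u i ^+ N)) -> exists N, subset_ideal (ipow P N) Q.
Proof.
move=> idQ Pu hu; have [E hE] := fin_all_exists hu.
(* The exponents collected so far are recorded in [b], and [K] exceeds the total still missing from
   the exponents [E]. A further factor from [P] meets, term by term, either a power that is already
   complete or one whose deficit it lowers. *)
suff H K : forall b : 'I_r -> nat, (\sum_i (E i - b i) < K)%N ->
    forall v, ipow P K v -> Q (\prod_i u i ^+ b i * v).
  exists (\sum_i (E i - 0)).+1 => v hv.
  by have := H _ (fun=> 0%N) (ltnSn _) v hv; rewrite big1 ?mul1r // => i _; rewrite expr0.
elim: K => [//|K IH] b hb v; elim=> [|x y c Px hy _ IHc].
  by rewrite mulr0; apply: ideal0.
rewrite mulrDr; apply: idealD => //; case: (Pu _ Px) => a ->.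
rewrite mulr_suml mulr_sumr; apply: ideal_sum => // i _.
have -> : \prod_l u l ^+ b l * (a i * u i * y)
    = a i * (\prod_l u l ^+ (b l + (l == i)) * y).
  rewrite [in RHS](bigD1 i) //= (bigD1 i) //= eqxx addn1 exprS.
  rewrite [in RHS](eq_bigr (fun l => u l ^+ b l)); first by ring.
  by move=> l /negPf->; rewrite addn0.
apply: idealM => //; case: (leqP (E i) (b i)) => hi.
  apply: idealMr => //; rewrite (bigD1 i) //= eqxx addn1; apply: idealMr => //.
  by rewrite -(subnK (leqW hi)) exprD; apply: idealM.
apply: IH => //; rewrite -ltnS; apply: leq_trans hb.
rewrite ltnS (bigD1 i) //= [X in (_ < X)%N](bigD1 i) //= eqxx.
rewrite (eq_bigr (fun l => (E l - b l)%N)); first by rewrite ltn_add2r; lia.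
by move=> l /negPf->; rewrite addn0.
Qed.

(** * Minimal primes *)

Definition minimal_over P (S : polyset k n) := subset_ideal S P /\
  forall Q, is_prime_ideal Q -> subset_ideal S Q -> subset_ideal Q P -> subset_ideal P Q.

(** In the localisation at [P] the radical of [I] is [P]. Among the ideals that contain [I] and
    avoid every [g * u ^+ N] with [g] outside [P], a maximal one is prime and contained in [P]; by
    minimality of [P] it contains [u], a contradiction. *)
Lemma minimal_over_nilpotent P I u : is_prime_ideal P -> is_ideal I -> minimal_over P I ->
  P u -> exists g N, ~ P g /\ I (g * u ^+ N).
Proof.
move=> prP idI [IP mP] Pu; apply: NNPP => hn.
pose C J := [/\ is_ideal J, subset_ideal I J & forall g N, ~ P g -> ~ J (g * u ^+ N)].
have [||J [[idJ IJ hJ] mJ]] := @ideal_max C I; first by move=> J [].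
  by split=> // g N Pg Ig; apply: hn; exists g, N.
have ext a : ~ J a -> exists g N r, ~ P g /\ J (g * u ^+ N - r * a).
  move=> Ja; apply: NNPP => hx; apply: Ja.
  pose J' f := exists2 r, True & J (f - r * a).
  have J'C : C J'.
    split.
    - split; first by exists 0 => //; rewrite mul0r subr0; apply: ideal0.
        move=> f g [r _ h] [r' _ h']; exists (r + r') => //.
        by rewrite mulrDl opprD addrACA; apply: idealD.
      move=> b f [r _ h]; exists (b * r) => //.
      by rewrite -mulrA -mulrBr; apply: idealM.
    - by move=> f /IJ h; exists 0 => //; rewrite mul0r subr0.
    - by move=> g N Pg [r _ h]; apply: hx; exists g, N, r.
  apply: (mJ J' J'C); last by exists 1 => //; rewrite mul1r subrr; apply: ideal0.
  by move=> f h; exists 0 => //; rewrite mul0r subr0.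
have prJ : is_prime_ideal J.
  split=> //.
    by move=> J1; apply: (hJ 1 0%N); [apply: prime_N1 | rewrite expr0 mulr1].
  move=> a b Jab; apply: NNPP => /not_or_and [/ext [g [N [r [Pg h]]]] /ext [g' [N' [r' [Pg' h']]]]].
  apply: (hJ (g * g') (N + N')%N); first exact: primeNM.
  have -> : g * g' * u ^+ (N + N') = (g * u ^+ N - r * a) * (g' * u ^+ N')
     + (r * a) * (g' * u ^+ N' - r' * b) + r * r' * (a * b) by rewrite exprD; ring.
  apply: idealD => //; last exact: idealM.
  by apply: idealD => //; [apply: idealMr | apply: idealM].
apply: (hJ 1 1%N); first exact: prime_N1.
rewrite mul1r expr1; apply: (mP J) => // f Jf; apply: NNPP => Pf.
by apply: (hJ f 0%N) => //; rewrite expr0 mulr1.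
Qed.

End Noetherian.

(** * Rank over the independent variables *)

Section TorsionRank.
Variables (k : fieldType) (n : nat).
Local Notation R := {mpoly k[n]}.
Implicit Types (I J P Q : polyset k n) (f g u v t : R).
Variable A : {set 'I_n}.
Local Notation T := (vars_in A).

(** Gaussian elimination without division: rows are cross-multiplied with a pivot row to clear the
    last column. *)
Lemma vars_in_dependence e r (M : 'I_r -> 'I_e -> R) : (e < r)%N ->
  (forall l a, T (M l a)) -> exists c : 'I_r -> R,
  [/\ forall l, T (c l), exists l, c l != 0 & forall a, \sum_l c l * M l a = 0].
Proof.
elim: e r M => [|e IH] r M er hM.
  exists (fun=> 1); split; last by case.
    by move=> _; apply: vars_in1.
  by exists (Ordinal er); apply: oner_neq0.
pose w := widen_ord (leqnSn e).
have [/forallP h0|] := boolP [forall l, M l ord_max == 0].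
  have [c [c1 c2 c3]] := IH r (fun l a => M l (w a)) (ltnW er) (fun l a => hM _ _).
  exists c; split=> // a; case: (unliftP ord_max a) => [b ->|->].
    have -> : lift ord_max b = w b by apply: ord_inj; apply: lift_max.
    exact: c3.
  by rewrite big1 // => l _; rewrite (eqP (h0 l)) mulr0.
rewrite negb_forall => /existsP [p]; case: r M er hM p => // r M er hM p p0.
set m := M p ord_max in p0.
pose M' (l : 'I_r) (a : 'I_e) := m * M (lift p l) (w a) - M (lift p l) ord_max * M p (w a).
have [||c [c1 [l0 c2] c3]] := IH r M'; first by [].
  move=> l a; apply: vars_inD; first by apply: vars_inM; apply: hM.
  by apply: vars_inN; apply: vars_inM; apply: hM.
pose d (l : 'I_r.+1) : R := if unlift p l is Some i then m * c i
  else - \sum_i c i * M (lift p i) ord_max.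
have dp : d p = - \sum_i c i * M (lift p i) ord_max by rewrite /d unlift_none.
have dl i : d (lift p i) = m * c i by rewrite /d liftK.
have sd a : \sum_l d l * M l a
    = \sum_i c i * (m * M (lift p i) a - M (lift p i) ord_max * M p a).
  rewrite (bigD1_ord p) //= dp mulNr mulr_suml -sumrN -big_split /=.
  by apply: eq_bigr => i _; rewrite dl; ring.
exists d; split.
- move=> l; case: (unliftP p l) => [i ->|->]; rewrite ?dl ?dp.
    by apply: vars_inM => //; apply: hM.
  by apply: vars_inN; apply: vars_in_sum => i _; apply: vars_inM => //; apply: hM.
- by exists (lift p l0); rewrite dl mulf_neq0.
- move=> a; rewrite sd; case: (unliftP ord_max a) => [b ->|->].
    have -> : lift ord_max b = w b by apply: ord_inj; apply: lift_max.
    exact: c3.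
  by rewrite big1 // => i _; rewrite /m; ring.
Qed.

Definition tspan (K : finType) (w : K -> R) J u :=
  exists2 c : K -> R, (forall a, T (c a)) & J (u - \sum_a c a * w a).

(** After inverting the nonzero polynomials in [A], the class of [u] modulo [J] lies in the span of
    [w]; the denominator [t] stays explicit. *)
Definition tgen (K : finType) (w : K -> R) J u :=
  exists t, [/\ T t, t != 0 & tspan w J (t * u)].

Section Tgen.
Variables (K : finType) (w : K -> R) (J : polyset k n).
Hypothesis idJ : is_ideal J.

Lemma tspanD u v : tspan w J u -> tspan w J v -> tspan w J (u + v).
Proof.
move=> [c Tc hc] [d Td hd]; exists (fun a => c a + d a).
  by move=> a; apply: vars_inD.
have -> : \sum_a (c a + d a) * w a = \sum_a c a * w a + \sum_a d a * w a.
  by rewrite -big_split; apply: eq_bigr => a _; rewrite mulrDl.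
by rewrite opprD addrACA; apply: idealD.
Qed.

Lemma tspanM t u : T t -> tspan w J u -> tspan w J (t * u).
Proof.
move=> Tt [c Tc hc]; exists (fun a => t * c a); first by move=> a; apply: vars_inM.
rewrite (eq_bigr (fun a => t * (c a * w a))); last by move=> a _; rewrite mulrA.
by rewrite -mulr_sumr -mulrBr; apply: idealM.
Qed.

Lemma tgen_ideal u : J u -> tgen w J u.
Proof.
move=> Ju; exists 1; split; [exact: vars_in1 | exact: oner_neq0 |].
exists (fun=> 0); first by move=> a; apply: vars_in0.
by rewrite big1 ?subr0 ?mul1r // => a _; rewrite mul0r.
Qed.

Lemma tgen_w a : tgen w J (w a).
Proof.
exists 1; split; [exact: vars_in1 | exact: oner_neq0 |].
exists (fun b => if b == a then 1 else 0).
  by move=> b; case: ifP => _; [apply: vars_in1 | apply: vars_in0].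
rewrite (bigD1 a) //= eqxx mul1r big1 ?addr0 ?mul1r ?subrr; first exact: ideal0.
by move=> b /negPf->; rewrite mul0r.
Qed.

Lemma tgenD u v : tgen w J u -> tgen w J v -> tgen w J (u + v).
Proof.
move=> [t [Tt t0 h]] [t' [Tt' t0' h']]; exists (t * t'); split.
- exact: vars_inM.
- exact: mulf_neq0.
- rewrite mulrDr; apply: tspanD; last by rewrite -mulrA; apply: tspanM.
  by rewrite [t * _]mulrC -mulrA; apply: tspanM.
Qed.

Lemma tgenM t u : T t -> tgen w J u -> tgen w J (t * u).
Proof.
move=> Tt [t' [Tt' t0' h']]; exists t'; split=> //.
by rewrite mulrCA; apply: tspanM.
Qed.

Lemma tgen_sum (L : Type) (s : seq L) (p : pred L) (F : L -> R) :
  (forall i, p i -> tgen w J (F i)) -> tgen w J (\sum_(i <- s | p i) F i).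
Proof. by move=> h; apply: big_ind => //; [apply: tgen_ideal; apply: ideal0 | apply: tgenD]. Qed.

Lemma tgen_div t u : T t -> t != 0 -> tgen w J (t * u) -> tgen w J u.
Proof.
move=> Tt t0 [t' [Tt' t0' h]]; exists (t' * t); split.
- exact: vars_inM.
- exact: mulf_neq0.
- by rewrite -mulrA.
Qed.

Lemma tgen_mod u v : J (u - v) -> tgen w J v -> tgen w J u.
Proof. by move=> h hv; rewrite -(subrK v u); apply: tgenD => //; apply: tgen_ideal. Qed.

End Tgen.

Lemma tgen_trans (K K' : finType) (w : K -> R) (w' : K' -> R) J J' u :
  is_ideal J' -> (forall a, tgen w' J' (w a)) -> (forall v, J v -> tgen w' J' v) ->
  tgen w J u -> tgen w' J' u.
Proof.
move=> idJ' hw hJ [t [Tt t0 [c Tc hc]]]; apply: (tgen_div Tt t0).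
rewrite -(subrK (\sum_a c a * w a) (t * u)); apply: tgenD => //; first exact: hJ.
by apply: tgen_sum => // a _; apply: tgenM.
Qed.

Lemma tgen_rank (K L : finType) (w : K -> R) (v : L -> R) J : is_ideal J ->
  (forall u, tgen w J u) -> (#|K| < #|L|)%N ->
  exists c : L -> R, [/\ forall l, T (c l), exists l, c l != 0 & J (\sum_l c l * v l)].
Proof.
move=> idJ hw KL.
have [t ht] := fin_all_exists (fun l => hw (v l)).
have [C hC] : exists C : L -> K -> R, forall l,
    (forall a, T (C l a)) /\ J (t l * v l - \sum_a C l a * w a).
  apply: (fin_all_exists (P := fun l D =>
    (forall a, T (D a)) /\ J (t l * v l - \sum_a D a * w a))) => l.
  by case: (ht l) => _ _ [D h1 h2]; exists D.
pose M (l : 'I_#|L|) (a : 'I_#|K|) := C (enum_val l) (enum_val a).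
have [|d [d1 [l0 d2] d3]] := @vars_in_dependence _ _ M KL.
  by move=> l a; apply: (hC _).1.
pose c l := d (enum_rank l).
have hc a : \sum_l c l * C l a = 0.
  have := d3 (enum_rank a); rewrite [X in _ -> X = _](reindex (fun i : 'I_#|L| => enum_val i)) /=.
    by under eq_bigr do rewrite /M enum_rankK; under [X in _ -> X = _]eq_bigr do rewrite /c enum_valK.
  by apply: onW_bij; apply: enum_val_bij.
exists (fun l => c l * t l); split.
- by move=> l; apply: vars_inM; [apply: d1 | case: (ht l)].
- exists (enum_val l0); rewrite mulf_neq0 //; first by rewrite /c enum_valK.
  by case: (ht (enum_val l0)).
- have -> : \sum_l c l * t l * v l = \sum_l c l * (t l * v l - \sum_a C l a * w a).
    under [RHS]eq_bigr do rewrite mulrBr mulr_sumr.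
    rewrite sumrB [X in _ = _ - X]exchange_big /= [X in _ = _ - X]big1 ?subr0.
      by apply: eq_bigr => l _; rewrite mulrA.
    move=> a _; transitivity ((\sum_l c l * C l a) * w a); last by rewrite hc mul0r.
    rewrite mulr_suml.
    by apply: eq_bigr => l _; rewrite mulrA.
  by apply: ideal_sum => // l _; apply: idealM => //; case: (hC l).
Qed.

End TorsionRank.

(** * Krull's height theorem *)

Section Krull.
Variables (k : fieldType) (n : nat).
Hypothesis char0 : [pchar k] =i pred0.
Local Notation R := {mpoly k[n]}.
Implicit Types (I J Q : polyset k n) (f g u v t : R).
Variables (P : polyset k n) (A : {set 'I_n}).
Hypothesis prP : is_prime_ideal P.
Hypothesis aiP : algindep P A.
Hypothesis algP : forall j, j \notin A -> exists f, [/\ f != 0, vars_in (j |: A) f & P f].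
Local Notation T := (vars_in A).

Let idP : is_ideal P := prime_ideal prP.

Lemma algebraic_equation j : exists e t (c : 'I_e -> R),
  [/\ T t, t != 0, forall a, T (c a) & P (t * 'X_j ^+ e - \sum_a c a * 'X_j ^+ a)].
Proof.
case: (boolP (j \in A)) => jA.
  exists 1%N, 1, (fun=> 'X_j); split.
  - exact: vars_in1.
  - exact: oner_neq0.
  - by move=> _; apply: vars_inX.
  - by rewrite big_ord1 expr0 expr1 mul1r mulr1 subrr; apply: ideal0.
case: (algP jA) => f [f0 vf Pf]; pose F := unipoly j f.
have F0 : F != 0.
  by apply: contra_neq f0 => e; rewrite -(unipoly_hornerX j f) -/F e horner0.
exists (size F).-1, (lead_coef F), (fun a => - F`_a); split.
- exact: vars_in_unipoly.
- by rewrite lead_coef_eq0.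
- by move=> a; apply: vars_inN; apply: vars_in_unipoly.
- suff -> : lead_coef F * 'X_j ^+ (size F).-1 - \sum_(a < (size F).-1) - F`_a * 'X_j ^+ a = f by [].
  rewrite -[RHS](unipoly_hornerX j) horner_coef -/F.
  have sF : size F = (size F).-1.+1 by rewrite prednK // lt0n size_poly_eq0.
  rewrite [in RHS]sF big_ord_recr /= addrC; congr (_ + _).
  by rewrite -sumrN; apply: eq_bigr => a _; rewrite mulNr opprK.
Qed.

(** Monomials with all exponents at most [b] suffice: a larger exponent is lowered by the algebraic
    equation of its variable, by induction on the total degree. *)
Lemma finite_rank : exists (K : finType) (w : K -> R), forall u, tgen A w P u.
Proof.
have [e he] := fin_all_exists algebraic_equation.
have [t ht] := fin_all_exists he.
have [c hc] : exists c : forall j, 'I_(e j) -> R, forall j,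
  [/\ T (t j), t j != 0, forall a, T (c j a) &
      P (t j * 'X_j ^+ e j - \sum_a c j a * 'X_j ^+ a)].
  exact: (fin_all_exists ht).
pose b := (\max_j e j)%N.
pose w (m : {ffun 'I_n -> 'I_b.+1}) : R := 'X_[[multinom (m i : nat) | i < n]].
exists {ffun 'I_n -> 'I_b.+1}, w.
suff hm m : tgen A w P 'X_[m].
  move=> u; rewrite (mpolyE u); apply: tgen_sum => // m _.
  by rewrite -mul_mpolyC; apply: tgenM => //; apply: vars_inC.
have [N] := ubnP (mdeg m); elim: N m => // N IH m mN.
have [/forallP hb|] := boolP [forall i, (m i < b.+1)%N].
  have -> : 'X_[m] = w [ffun i => inord (m i)].
    by rewrite /w; congr mpolyX; apply/mnmP => i; rewrite mnmE ffunE inordK.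
  exact: tgen_w.
rewrite negb_forall => /existsP [j]; rewrite -leqNgt => bj.
have ej : (e j <= m j)%N by apply: leq_trans (ltnW bj); rewrite /b (bigD1 j) //= leq_maxl.
have [Tt t0 Tc hP] := hc j.
pose m' := (m - U_(j) *+ e j)%MM.
have Xm (a : nat) : 'X_[m'] * 'X_j ^+ a = 'X_[m' + U_(j) *+ a] :> R.
  by rewrite mpolyXn -mpolyXD.
have em : (m' + U_(j) *+ e j = m)%MM.
  apply: submK; apply/mnm_lepP => i; rewrite mulmnE mnm1E.
  by case: eqP => [<-|_]; rewrite ?mul1n.
apply: (tgen_div Tt t0); apply: (@tgen_mod _ _ _ _ _ _ idP _ (\sum_a c j a * 'X_[m' + U_(j) *+ a])).
  have -> : t j * 'X_[m] - \sum_a c j a * 'X_[m' + U_(j) *+ a]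
     = 'X_[m'] * (t j * 'X_j ^+ e j - \sum_a c j a * 'X_j ^+ a).
    rewrite mulrBr mulrCA Xm em mulr_sumr; congr (_ - _); apply: eq_bigr => a _.
    by rewrite mulrCA Xm.
  exact: idealM.
apply: tgen_sum => // a _; apply: tgenM => //; apply: IH.
rewrite -ltnS; apply: leq_trans mN; rewrite ltnS -em !mdegD ltn_add2l !mdegMn !mdeg1 !mul1n.
exact: ltn_ord.
Qed.

(** Inverting the nonzero polynomials in [A] makes [R/P] a field: the powers of [g] are dependent,
    and the relation can be divided by the power of [g] at its lowest nonzero coefficient, which
    becomes a multiple of [g] modulo [P]. *)
Lemma invert_mod g : ~ P g -> exists t g', [/\ T t, t != 0 & P (t - g * g')].
Proof.
move=> Pg; have [K [w hw]] := finite_rank.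
have [|c [Tc [l0 c0] hc]] := @tgen_rank _ _ A K 'I_#|K|.+1 w (fun a : 'I_#|K|.+1 => g ^+ a) P idP hw.
  by rewrite card_ord.
case: (@arg_minnP _ l0 (fun l => c l != 0) (fun l => val l) c0) => a ca ma.
exists (c a), (- \sum_(l < #|K|.+1 | (a < l)%N) c l * g ^+ (l - a.+1)); split=> //.
suff : P (g ^+ a * (c a - g * - (\sum_(l < #|K|.+1 | (a < l)%N) c l * g ^+ (l - a.+1)))).
  by move=> /(primeM prP) [/(primeX prP) //|].
suff -> : g ^+ a * (c a - g * - (\sum_(l < #|K|.+1 | (a < l)%N) c l * g ^+ (l - a.+1)))
   = \sum_l c l * g ^+ l by [].
rewrite [RHS](bigID (fun l : 'I_#|K|.+1 => (a <= l)%N)) /= [X in _ = _ + X]big1 ?addr0; last first.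
  move=> l; rewrite -ltnNge => la; have [->|/ma] := eqVneq (c l) 0; first by rewrite mul0r.
  by rewrite leqNgt la.
rewrite [RHS](bigD1 a) //= mulrN opprK mulrDr [g ^+ a * c a]mulrC; congr (_ + _).
rewrite mulrA -exprSr mulr_sumr; apply: eq_big => [l|l la].
  by rewrite ltn_neqAle eq_sym andbC.
by rewrite mulrCA -exprD subnKC.
Qed.

(** Induction on [N]: finitely many [z i] generate [P^N], so modulo [P^(N+1)] the products of the
    [z i] with generators of [R/P] span it. *)
Lemma finite_rank_ipow N : exists (K : finType) (w : K -> R), forall u, tgen A w (ipow P N) u.
Proof.
have [K1 [w1 hw1]] := finite_rank.
elim: N => [|N [K [w hw]]].
  by exists void, (fun x : void => match x with end) => u; apply: tgen_ideal.
have idN := ipow_ideal N idP; have idSN := ipow_ideal N.+1 idP.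
have [r [z [hz hN]]] := ideal_fg idN.
pose w' (x : K + 'I_r * K1) : R := match x with inl a => w a | inr p => z p.1 * w1 p.2 end.
exists (K + 'I_r * K1)%type, w' => u.
apply: (tgen_trans idSN _ _ (hw u)) => [a|v]; first exact: (@tgen_w _ _ A _ w' _ idSN (inl a)).
move=> /hN [c ->]; apply: tgen_sum => // i _.
have [t [Tt t0 [d Td hd]]] := hw1 (c i).
apply: (tgen_div Tt t0).
apply: (@tgen_mod _ _ _ _ _ _ idSN _ (\sum_a d a * (z i * w1 a))).
  have -> : t * (c i * z i) - \sum_a d a * (z i * w1 a) = (t * c i - \sum_a d a * w1 a) * z i.
    rewrite mulrBl mulrA mulr_suml; congr (_ - _); apply: eq_bigr => a _; ring.
  exact: (@iprodM _ _ P (ipow P N)).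
by apply: tgen_sum => // a _; apply: tgenM => //; exact: (@tgen_w _ _ A _ w' _ idSN (inr (i, a))).
Qed.

(* Derivatives in the dependent variables lower the order along [P] by at most one each; a
   polynomial of low degree in these variables therefore cannot lie in a high power of [P]. *)
Lemma monomials_independent h (e : 'I_h -> 'I_n) b L (c : {ffun 'I_h -> 'I_b} -> R) :
  injective e -> (forall i, e i \notin A) -> (h * b.-1 < L)%N -> (forall l, T (c l)) ->
  ipow P L (\sum_l c l * 'X_[expmon e (fun i => l i)]) -> forall l, c l = 0.
Proof.
move=> inj_e eA hL Tc hP l; apply: NNPP => /eqP cl.
pose mm (l : {ffun 'I_h -> 'I_b}) := expmon e (fun i => l i).
(* Choose a monomial of largest degree among those with nonzero coefficient. Differentiating by it
   annihilates the other terms, whose monomials it does not divide, and leaves [c l0] times a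
   product of factorials. *)
case: (@arg_maxnP _ l (fun l => c l != 0) (fun l => mdeg (mm l)) cl) => l0 c0 m0.
pose js := flatten [seq nseq (mm l0 i) i | i <- enum 'I_n].
have szjs : size js = mdeg (mm l0).
  rewrite size_flatten /shape -map_comp sumnE big_map mdegE big_enum /=.
  by apply: eq_bigr => i _; rewrite size_nseq.
have jsA j : j \in js -> j \notin A.
  move=> /flatten_mapP [i _]; rewrite mem_nseq => /andP[mi /eqP->].
  case: (pickP (fun a => e a == i)) => [a /eqP <- //|hi].
  by rewrite expmon_out // in mi => a; rewrite hi.
have dM (ks : seq 'I_n) t u : (forall j, j \in ks -> j \notin A) -> T t ->
    foldr (mderiv (R := k)) (t * u) ks = t * foldr (mderiv (R := k)) u ks.
  move=> hk Tt; elim: ks hk => //= j ks IH hk; rewrite IH => [|i ik].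
    by rewrite mderivM Tt ?mul0r ?add0r //; apply: hk; rewrite mem_head.
  by apply: hk; rewrite inE ik orbT.
have dP (ks : seq 'I_n) N u : ipow P (N + size ks) u -> ipow P N (foldr (mderiv (R := k)) u ks).
  elim: ks N => [|j ks IH] N /=; first by rewrite addn0.
  by rewrite addnS -addSn => /IH /(ipow_mderiv j idP).
have szL : (size js < L)%N.
  rewrite szjs mdeg_expmon; apply: leq_ltn_trans hL.
  rewrite -[X in (_ <= X * _)%N]card_ord -sum_nat_const; apply: leq_sum => i _.
  by have := ltn_ord (l0 i); move: (l0 i : nat) => x; lia.
have : P ((\sum_l c l * 'X_[mm l])^`M[mm l0]).
  rewrite mderivm_foldr; apply: (@iprod_subl _ _ P (ipow P 0)) => //.
  apply: (dP js 1%N); apply: ipow_leq hP => //.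
rewrite raddf_sum (bigD1 l0) //= big1 ?addr0 => [|l' ll0].
  rewrite mderivm_foldr /= dM // -mderivm_foldr mderivmX.
  have -> : (mm l0 - mm l0)%MM = 0%MM by rewrite -{1}[mm l0]add0m addmK.
  rewrite mpolyX0 => hc; move/eqP: c0; apply; apply: aiP => //.
  move: hc; rewrite -scalerAr mulr1 -mul_mpolyC => /(primeM prP) [/(prime_const prP) /eqP|//].
  rewrite natr_eq0_char0 // eqn0Ngt prodn_gt0 // => i.
  by rewrite ffactnn fact_gt0.
rewrite mderivm_foldr /= dM // -mderivm_foldr mderivmX.
have [->|c'] := eqVneq (c l') 0; first by rewrite mul0r.
suff /existsP [i hi] : [exists i, (mm l' i < mm l0 i)%N].
  by rewrite (bigD1 i) //= ffact_small // mul0n scale0r mulr0.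
apply: contraR ll0; rewrite negb_exists => /forallP hle.
have le1 i : (mm l0 i <= mm l' i)%N by rewrite leqNgt hle.
have := m0 l' c'; rewrite /geq /= !mdegE => le2.
have eqm i : mm l0 i = mm l' i.
  apply/eqP; rewrite eqn_leq le1 /= leqNgt; apply/negP => lt.
  move: le2; rewrite leqNgt => /negP; apply; rewrite (bigD1 i) //= [X in (_ < X)%N](bigD1 i) //=.
  rewrite -addSn; apply: leq_add => //; apply: leq_sum => a _; exact: le1.
apply/eqP/ffunP => i; apply: val_inj => /=.
by have := eqm (e i); rewrite /mm !expmonE.
Qed.

(** One family serves every [L]. By minimality some [P^N] falls into the ideal of [f] after
    localisation at [P], so generators of [R/P^N] suffice; a multiplier [g] outside [P] is traded
    for a denominator in the variables of [A]. *)
Lemma tgen_generators i (f : 'I_i -> R) : (forall j, P (f j)) -> minimal_over P (gen f) ->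
  exists (K : finType) (w : K -> R), forall L u,
    tgen A w (fun v => exists2 g, gen f g & ipow P L (v - g)) u.
Proof.
move=> Pf mP; have idf := gen_ideal f.
pose Q v := exists2 g, ~ P g & gen f (g * v).
have idQ : is_ideal Q.
  split; first by exists 1; [exact: prime_N1 | rewrite mulr0; apply: ideal0].
    move=> u v [g Pg hg] [g' Pg' hg']; exists (g * g'); first exact: primeNM.
    rewrite mulrDr; apply: idealD => //; last by rewrite -mulrA; apply: idealM.
    by rewrite [g * _]mulrC -mulrA; apply: idealM.
  by move=> r u [g Pg hg]; exists g => //; rewrite mulrCA; apply: idealM.
have [r [z [hz hgz]]] := ideal_fg idP.
have [N hN] : exists N, subset_ideal (ipow P N) Q.
  apply: (ipow_nilpotent idQ hgz) => a.
  have [g [N [Pg h]]] := minimal_over_nilpotent prP idf mP (hz a).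
  by exists N; exists g.
have [K [w hw]] := finite_rank_ipow N; exists K, w => L u.
have idL := ipow_ideal L idP.
set J := fun v => _.
have idJ : is_ideal J.
  split; first by exists 0; [apply: ideal0 | rewrite subrr; apply: ideal0].
    move=> a b [g hg ha] [g' hg' hb]; exists (g + g'); first exact: idealD.
    by rewrite opprD addrACA; apply: idealD.
  by move=> b v [g hg hv]; exists (b * g); [apply: idealM | rewrite -mulrBr; apply: idealM].
apply: (tgen_trans idJ _ _ (hw u)) => [a|v /hN [g Pg hg]]; first exact: tgen_w.
have [t [g' [Tt t0 hP]]] := invert_mod Pg.
(* As [t - g * g'] lies in [P], its [L]-th power lies in [P^L]; up to a multiple of [g] this power
   is [t ^+ L]. *)
have [y hy] : exists y, (t - g * g') ^+ L = t ^+ L - g * y.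
  elim: L {idL J idJ} => [|L [y IH]]; first by exists 0; rewrite !expr0 mulr0 subr0.
  by exists (y * (t - g * g') + t ^+ L * g'); rewrite exprSr IH exprSr; ring.
apply: (tgen_div (t := t ^+ L)); [exact: vars_in_exp | by rewrite expf_neq0 |].
apply: tgen_ideal; exists (y * (g * v)); first exact: idealM.
have -> : t ^+ L * v - y * (g * v) = (t - g * g') ^+ L * v by rewrite hy; ring.
by apply: idealMr => //; apply: ipow_exp.
Qed.

(** Applying the hypothesis repeatedly to the coefficients expands [u] in monomials in [f] with
    coefficients from the span of [w]; monomials of total degree at least [L] fall into [P^L]. *)
Lemma tgen_monomials i (f : 'I_i -> R) (K : finType) (w : K -> R) L : (forall j, P (f j)) ->
  (forall u, tgen A w (fun v => exists2 g, gen f g & ipow P L (v - g)) u) ->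
  forall u, tgen A (fun x : {ffun 'I_i -> 'I_L} * K => \prod_j f j ^+ x.1 j * w x.2) (ipow P L) u.
Proof.
move=> Pf hw; set w' := fun x => _; have idL := ipow_ideal L idP.
pose F (b : 'I_i -> nat) := \prod_j f j ^+ b j.
suff H N : forall b u, (L <= \sum_j b j + N)%N -> tgen A w' (ipow P L) (F b * u).
  move=> u; have := H L (fun=> 0%N) u (leq_addl _ _).
  by rewrite /F big1 ?mul1r // => j _; rewrite expr0.
elim: N => [|N IH] b u hb.
  apply: tgen_ideal => //; apply: idealMr => //; rewrite addn0 in hb; apply: ipow_leq hb _ _ => //.
  rewrite /F; elim/big_rec2: _ => [|j a c _ h] //.
  by apply: ipowM => //; apply: ipow_exp.
have [hL|] := leqP L (\sum_j b j); first by apply: IH; apply: leq_trans hL (leq_addr _ _).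
move=> bL; have [t [Tt t0 [c Tc [g [d ->] hd]]]] := hw u.
apply: (tgen_div Tt t0).
have -> : t * (F b * u) = F b * (t * u - \sum_a c a * w a - \sum_j d j * f j)
   + \sum_a c a * (F b * w a) + \sum_j F (fun l => b l + (l == j))%N * d j.
  have -> : \sum_a c a * (F b * w a) = F b * \sum_a c a * w a.
    by rewrite mulr_sumr; apply: eq_bigr => a _; rewrite mulrCA.
  have -> : \sum_j F (fun l => b l + (l == j))%N * d j = F b * \sum_j d j * f j.
    rewrite mulr_sumr; apply: eq_bigr => j _; rewrite /F (bigD1 j) //= [in RHS](bigD1 j) //=.
    rewrite eqxx addn1 exprS (eq_bigr (fun l => f l ^+ b l)); first by ring.
    by move=> l /negPf->; rewrite addn0.
  by ring.
apply: tgenD => //; last first.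
  apply: tgen_sum => // j _; apply: IH; rewrite (bigD1 j) //= eqxx.
  rewrite (eq_bigr b); last by move=> l /negPf->; rewrite addn0.
  by move: hb; rewrite (bigD1 j) //=; lia.
apply: tgenD => //; first by apply: tgen_ideal => //; apply: idealM.
apply: tgen_sum => // a _; apply: tgenM => //.
have bj j : (b j < L)%N by apply: leq_ltn_trans bL; rewrite (bigD1 j) //= leq_addr.
have -> : F b * w a = w' ([ffun j => Ordinal (bj j)], a).
  by rewrite /w' /=; congr (_ * _); apply: eq_bigr => j _; rewrite ffunE.
exact: tgen_w.
Qed.

(** Over the fractions of polynomials in [A], the space [R/P^L] is spanned by [L ^ i * #|K|]
    elements, yet it contains [b ^ h] independent monomials in the remaining variables when
    [L > h * b.-1]. *)
Lemma krull_bound i (f : 'I_i -> R) : (forall j, P (f j)) -> minimal_over P (gen f) ->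
  (n - #|A| <= i)%N.
Proof.
move=> Pf mP; set h := (n - #|A|)%N; case: (leqP h i) => // ih; exfalso.
have [K [w hw]] := tgen_generators Pf mP.
have cA : #|~: A| = h by rewrite cardsCs setCK card_ord.
have [e inj_e eA] := ord_emb cA.
(* This size of [b] gives [(h * b) ^ i * #|K| < b ^ i.+1 <= b ^ h], fewer generators than
   independent monomials. *)
pose b := (h ^ i * #|K|).+1; pose L := (h * b)%N.
have hwL := tgen_monomials Pf (hw L).
have h0 : (0 < h)%N by apply: leq_ltn_trans ih.
have [|c [Tc [l cl] hc]] := @tgen_rank _ _ A _ {ffun 'I_h -> 'I_b} _
    (fun l => 'X_[expmon e (fun i => l i)]) _ (ipow_ideal L idP) hwL.
  rewrite card_prod !card_ffun !card_ord /L expnMn.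
  apply: (@leq_trans (b ^ i.+1)); last by rewrite leq_pexp2l.
  rewrite expnS mulnAC ltn_pmul2r ?expn_gt0 //; exact: ltnSn.
move/eqP: cl; apply; apply: (monomials_independent inj_e _ _ Tc hc).
  by move=> j; have := eA j; rewrite inE.
by rewrite /L ltn_pmul2l.
Qed.

End Krull.

Lemma krull_height (k : fieldType) (n : nat) (P : polyset k n) h i (f : 'I_i -> {mpoly k[n]}) :
  [pchar k] =i pred0 -> is_prime_ideal P -> has_height P h ->
  minimal_over P (gen f) -> (h <= i)%N.
Proof.
move=> char0 prP hP mP.
case: (height_algindep char0 prP hP) => A [aiA alA eA].
have -> : h = (n - #|A|)%N by lia.
apply: (krull_bound char0 prP aiA alA) (mP).
by move=> j; case: mP => s _; apply: s; apply: gen_mem.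
Qed.

(** * Counting minimal primes *)

Section Bezout.
Variables (k : fieldType) (n : nat).
Hypothesis char0 : [pchar k] =i pred0.
Local Notation R := {mpoly k[n]}.
Implicit Types (I J P Q : polyset k n) (f g u v : R).

Lemma height_exists P : is_prime_ideal P -> exists h, has_height P h.
Proof. by move=> /(prime_height char0) [A [_ _ h]]; exists (n - #|A|)%N. Qed.

Lemma height_mono P Q h h' : is_prime_ideal Q -> subset_ideal P Q ->
  has_height P h -> has_height Q h' -> (h <= h')%N.
Proof.
move=> prQ PQ [cP _] [_ mQ]; have [QP|nQP] := classic (subset_ideal Q P); last first.
  apply/ltnW/mQ; apply: (prime_chain_extend prQ _ cP); split=> //.
  by apply: NNPP => hn; apply: nQP => f Qf; apply: NNPP => Pf; apply: hn; exists f.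
(* [P] and [Q] have the same elements but may differ as predicates, so the top of the chain is
   replaced by [Q]. *)
apply: mQ; case: cP => c [pc sc ch]; exists (fun i => if i == h then Q else c i); split.
- by move=> i ih; case: eqP => // _; apply: pc.
- move=> i ih; have -> : (i == h) = false by lia.
  case: (sc i ih) => s1 [f [f1 f2]]; case: eqP => [e|_]; last by split=> //; exists f.
  rewrite e ch in s1 f1; split=> [u /s1 /PQ //|]; by exists f; split=> //; apply: PQ.
- by rewrite eqxx.
Qed.

(** Take a prime of least height between [S] and [Q]; a prime over [S] inside it has at least that
    height, hence the same elements. *)
Lemma minimal_prime_exists Q (S : polyset k n) : is_prime_ideal Q -> subset_ideal S Q ->
  exists P, [/\ is_prime_ideal P, subset_ideal P Q & minimal_over P S].
Proof.
move=> prQ SQ.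
pose C h := exists P, [/\ is_prime_ideal P, subset_ideal P Q, subset_ideal S P & has_height P h].
have ex : exists h, asb (C h).
  by case: (height_exists prQ) => h hh; exists h; apply/asbP; exists Q; split.
case: (ex_minnP ex) => h /asbP [P [prP PQ SP hP]] mh.
exists P; split=> //; split=> // P' prP' SP' P'P.
case: (height_exists prP') => h' hh'; apply: (same_height_eq prP P'P hh' hP).
by apply: mh; apply/asbP; exists P'; split=> // f /P'P /PQ.
Qed.

Lemma primes_ladder_bound d (J : nat -> polyset k n) (f : nat -> R) i h M
    (q : 'I_M -> polyset k n) : (0 < d)%N -> (0 < M)%N ->
  (forall l, (l <= i)%N -> is_ideal (J l)) ->
  (forall l, (l < i)%N -> ladder_step d (J l) (J l.+1) (f l)) ->
  (forall j, is_prime_ideal (q j)) -> (forall j, has_height (q j) h) ->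
  (forall j, subset_ideal (J i) (q j)) ->
  (forall j l, j != l -> exists2 g, q l g & ~ q j g) ->
  (i <= h)%N /\ (i = h -> (M <= d ^ i)%N).
Proof.
move=> d0 M0 idJ st prq hq Jq ne.
have [A hA] := fin_all_exists (fun j => height_algindep char0 (prq j) (hq j)).
have hn : (h <= n)%N := height_leq_nvars char0 (prq (Ordinal M0)) (hq _).
case: (@hasindep_primes k n M q A (n - h) prq) => // [j|j|c hc].
- by case: (hA j).
- by case: (hA j) => _ _; lia.
have [|b1 b2] := @ladder_bound k n d J f i M c (n - h) d0 M0 idJ st.
  by move=> E; apply: hasindep_sub (hc E) => u Ju j; apply: Jq.
split; first lia.
by move=> e; apply: b2; lia.
Qed.

(** * Distinct minimal primes of equal height over equations of bounded degree *)

Section Count.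
Variables (d h M : nat) (L : finType) (F : L -> R) (q : 'I_M -> polyset k n).
Hypothesis d_gt0 : (0 < d)%N.
Hypothesis sizeF : forall l, (msize (F l) <= d.+1)%N.
Hypothesis prq : forall j, is_prime_ideal (q j).
Hypothesis hq : forall j, has_height (q j) h.
Hypothesis qF : forall j l, q j (F l).
Hypothesis minq : forall j Q, is_prime_ideal Q -> (forall l, Q (F l)) ->
  subset_ideal Q (q j) -> subset_ideal (q j) Q.
Hypothesis neq : forall j l, j != l -> exists2 g, q l g & ~ q j g.

(** Restricting to primes below some [q j] stands in for localisation at the [q j]. *)
Definition local_prime (f : nat -> R) i Q :=
  [/\ is_prime_ideal Q, (forall a, (a < i)%N -> Q (f a)) & exists j, subset_ideal Q (q j)].

Definition local_radical (f : nat -> R) i : polyset k n :=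
  fun u => forall Q, local_prime f i Q -> Q u.

Lemma local_radical_ideal (f : nat -> R) i : is_ideal (local_radical f i).
Proof.
split=> [Q [prQ _ _]|u v hu hv Q lQ|r u hu Q lQ].
- exact: (ideal0 (prime_ideal prQ)).
- by apply: idealD; [case: lQ => /prime_ideal | apply: hu | apply: hv].
- by apply: idealM; [case: lQ => /prime_ideal | apply: hu].
Qed.

Lemma local_prime_ext (f f' : nat -> R) i Q : (forall a, (a < i)%N -> f a = f' a) ->
  local_prime f i Q -> local_prime f' i Q.
Proof. by move=> e [h1 h2 h3]; split=> // a ai; rewrite -e //; apply: h2. Qed.

Lemma local_radical_ext (f f' : nat -> R) i u : (forall a, (a < i)%N -> f a = f' a) ->
  local_radical f i u -> local_radical f' i u.
Proof.
by move=> e hu Q lQ; apply: hu; apply: local_prime_ext lQ => a ai; rewrite e.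
Qed.

Definition local_ladder (f : nat -> R) i := forall l, (l < i)%N ->
  ladder_step d (local_radical f l) (local_radical f l.+1) (f l).

(** The ladder bounds any family of distinct such primes by [d ^ i], so one of largest size exists;
    a prime different from all its members could be added to it. *)
Lemma finite_local_primes (f : nat -> R) i : local_ladder f i -> exists M' (Q : 'I_M' -> polyset k n),
  (forall a, local_prime f i (Q a) /\ has_height (Q a) i) /\
  (forall P, local_prime f i P -> has_height P i ->
     exists a, subset_ideal P (Q a) /\ subset_ideal (Q a) P).
Proof.
move=> lad.
pose C M' := exists Q : 'I_M' -> polyset k n,
  (forall a, local_prime f i (Q a) /\ has_height (Q a) i) /\
  (forall a b, a != b -> exists2 g, Q b g & ~ Q a g).
have bnd M' : asb (C M') -> (M' <= d ^ i)%N.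
  move=> /asbP [Q [hQ neQ]]; have [->//|M0] := posnP M'.
  have prQ a : is_prime_ideal (Q a) by case: (hQ a) => -[].
  have JQ a : subset_ideal (local_radical f i) (Q a) by move=> u; apply; case: (hQ a).
  by have [_] := primes_ladder_bound d_gt0 M0 (fun l _ => local_radical_ideal f l) lad
    prQ (fun a => (hQ a).2) JQ neQ; apply.
have ex : exists M', asb (C M').
  by exists 0%N; apply/asbP; exists (fun=> fun=> True); split=> [[]|[]].
case: (ex_maxnP ex bnd) => M' /asbP [Q [hQ neQ]] mx.
exists M', Q; split=> // P lP hP; apply: NNPP => hn.
have /mx : asb (C M'.+1); last by rewrite ltnn.
apply/asbP; exists (fun x => if unlift ord0 x is Some a then Q a else P); split.
  by move=> x; case: (unliftP ord0 x) => [a _|_]; [apply: hQ | split].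
have prP : is_prime_ideal P by case: lP.
have prQ a : is_prime_ideal (Q a) by case: (hQ a) => -[].
have hQa a : has_height (Q a) i by case: (hQ a).
have sep P1 P2 : ~ subset_ideal P1 P2 -> exists2 g, P1 g & ~ P2 g.
  move=> ns; apply: NNPP => hx; apply: ns => g h1; apply: NNPP => h2.
  by apply: hx; exists g.
move=> x y; case: (unliftP ord0 x) => [a ->|->]; case: (unliftP ord0 y) => [b ->|->] //.
- by rewrite (inj_eq lift_inj); apply: neQ.
- move=> _; apply: sep => PQ; apply: hn; exists a; split=> //.
  exact: (same_height_eq (prQ a) PQ hP (hQa a)).
- move=> _; apply: sep => QP; apply: hn; exists b; split=> //.
  exact: (same_height_eq prP QP (hQa b) hP).
Qed.

(** The next element combines the [F l] with powers of one constant [c] as coefficients, chosen to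
    avoid the finitely many local primes of height [i]. None of these contains all [F l]: by [minq]
    it would contain some [q j], whose height [h] exceeds [i]. *)
Lemma local_ladder_exists i : (i <= h)%N -> exists f : nat -> R,
  (forall a, (a < i)%N -> forall j, q j (f a)) /\ local_ladder f i.
Proof.
elim: i => [|i IH] ih; first by exists (fun=> 0); split=> [a|l].
have [f [fq lad]] := IH (ltnW ih).
have [M' [Q [hQ allQ]]] := finite_local_primes lad.
pose G : {poly R} := \sum_l F l *: 'X^(enum_rank l).
have coefG l : G`_(enum_rank l) = F l.
  rewrite /G coef_sum (bigD1 l) //= coefZ coefXn eqxx mulr1 big1 ?addr0 // => l' ne.
  rewrite coefZ coefXn; case: eqP => [/ord_inj/enum_rank_inj e|]; last by rewrite mulr0.
  by rewrite e eqxx in ne.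
have [||c hc] := @avoid _ char0 n 'I_M' Q (fun=> G).
- by move=> a; apply: ideal_kspace; apply: prime_ideal; case: (hQ a) => -[].
- move=> a; have [[pra _ [j Qj]] ha] := hQ a; apply: NNPP => hn.
  have sub : subset_ideal (q j) (Q a).
    apply: minq => // l; apply: NNPP => nl; apply: hn; exists (enum_rank l).
    by rewrite coefG.
  have := height_mono pra sub (hq j) ha; lia.
pose f' a := if a == i then G.[c%:MP] else f a.
have ff' a : (a < i)%N -> f a = f' a by rewrite /f' => /ltn_eqF->.
have GE : G.[c%:MP] = \sum_l (c ^+ enum_rank l) *: F l.
  rewrite horner_sum; apply: eq_bigr => l _.
  by rewrite hornerZ hornerXn -(rmorphXn (@mpolyC n k)) mulrC mul_mpolyC.
have fi : f' i = G.[c%:MP] by rewrite /f' eqxx.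
have f'q j : q j (f' i).
  have idj := prime_ideal (prq j).
  by rewrite fi GE; apply: ideal_sum => // l _; apply: idealZ => //; apply: qF.
exists f'; split.
  move=> a; rewrite ltnS leq_eqVlt => /orP[/eqP->|ai j]; first exact: f'q.
  by rewrite -ff' //; apply: fq.
move=> l; rewrite ltnS leq_eqVlt => /orP[/eqP-> {l}|li]; last first.
  have e1 a : (a < l.+1)%N -> f a = f' a by move=> al; apply: ff'; lia.
  have e2 a : (a < l)%N -> f a = f' a by move=> al; apply: ff'; lia.
  case: (lad l li) => s1 s2 s3 s4; rewrite -ff' //; split=> //.
  - move=> u /(local_radical_ext (fun a al => esym (e2 a al))) /s1.
    exact: local_radical_ext.
  - exact: local_radical_ext s2.
  - move=> g /(local_radical_ext (fun a al => esym (e2 a al))) /s3.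
    exact: local_radical_ext.
split.
- by move=> u hu P [p1 p2 p3]; apply: hu; split=> // a ai; apply: p2; apply: ltnW.
- by move=> P [_ p2 _]; apply: p2.
(* Below [P] lies a prime minimal over the first [i] elements. Krull's theorem bounds its height by
   [i] from above and the ladder from below, so it is one of the [Q a], which avoid the new element;
   hence it contains [g]. *)
- move=> g hg P [prP fP [j Pj]].
  pose fo (a : 'I_i) := f' a.
  have foP : subset_ideal (gen fo) P.
    by apply: gen_sub; [apply: prime_ideal | move=> a; apply: fP].
  have [P' [prP' P'P minP']] := minimal_prime_exists prP foP.
  have [h' hh'] := height_exists prP'.
  have le1 := krull_height char0 prP' hh' minP'.
  have lP' : local_prime f' i P'.
    split=> //; last by exists j => u /P'P /Pj.
    by move=> a ai; case: minP' => s _; apply: s; apply: (gen_mem fo (Ordinal ai)).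
  have lP'f : local_prime f i P' by apply: local_prime_ext lP' => a ai; rewrite ff'.
  have [le2 _] : (i <= h')%N /\ (i = h' -> (1 <= d ^ i)%N).
    apply: (@primes_ladder_bound d (local_radical f) f i h' 1 (fun=> P')) => //.
    + by move=> l _; apply: local_radical_ideal.
    + by move=> _ u; apply.
    + by move=> a b; rewrite !ord1.
  have eh : h' = i by apply/eqP; rewrite eqn_leq le1.
  rewrite {}eh in hh'.
  have [a [s1 s2]] := allQ P' lP'f hh'.
  have /(primeM prP') [/s1|/P'P //] := hg P' lP'.
  by rewrite fi => /hc.
- rewrite fi GE; apply: leq_trans (msize_sum _ _ _) _.
  apply/bigmax_leqP => l _; apply: leq_trans (msizeZ_le _ _) _; exact: sizeF.
Qed.

Lemma minimal_primes_count : (M <= d ^ h)%N.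
Proof.
have [->//|M0] := posnP M.
have [f [fq lad]] := local_ladder_exists (leqnn h).
have Jq j : subset_ideal (local_radical f h) (q j).
  by move=> u; apply; split=> [|a ai|]; [exact: prq | exact: fq | exists j].
by have [_] := primes_ladder_bound d_gt0 M0 (fun l _ => local_radical_ideal f l) lad
  prq hq Jq neq; apply.
Qed.

End Count.
End Bezout.

(** * The torus action *)

Section Torus.
Variables (k : fieldType) (n : nat).
Local Notation R := {mpoly k[n]}.
Implicit Types (P Q : polyset k n) (f g u v : R) (z y : 'I_n -> k).

HB.instance Definition _ z := GRing.RMorphism.copy (@act k n z) (@act k n z).

Lemma actC z c : act z c%:MP = c%:MP. Proof. by rewrite /act comp_mpolyC. Qed.
Lemma actX z i : act z 'X_i = z i *: 'X_i.
Proof. by rewrite /act comp_mpolyXU -tnth_nth tnth_mktuple. Qed.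

Lemma act_act z y f : act z (act y f) = act (fun i => z i * y i) f.
Proof.
apply: (@mpoly_rmorph_eq _ _ _ (act z \o act y) (act (fun i => z i * y i))) => [c|i] /=.
  by rewrite !actC.
by rewrite !actX -mul_mpolyC rmorphM /= actC actX mul_mpolyC scalerA mulrC.
Qed.

Lemma act_ext z y f : z =1 y -> act z f = act y f.
Proof.
move=> e; apply: (@mpoly_rmorph_eq _ _ _ (act z) (act y)) => [c|i] /=; first by rewrite !actC.
by rewrite !actX e.
Qed.

Lemma act1 z f : (forall i, z i = 1) -> act z f = f.
Proof.
move=> e; apply: (@mpoly_rmorph_eq _ _ _ (act z) idfun) => [c|i] /=; first by rewrite actC.
by rewrite actX e scale1r.
Qed.

Lemma meval_act z y f : (act z f).@[y] = f.@[fun i => z i * y i].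
Proof.
rewrite /act comp_mpoly_meval; apply: meval_eq => i.
by rewrite tnth_mktuple mevalZ mevalXU.
Qed.

Lemma msize_act z f : (msize (act z f) <= msize f)%N.
Proof.
have -> : act z f = \sum_(m <- msupp f) (f@_m * \prod_i z i ^+ m i) *: 'X_[m].
  rewrite {1}(mpolyE f) (raddf_sum (act z)); apply: eq_bigr => m _ /=.
  rewrite -mul_mpolyC rmorphM /= actC mul_mpolyC -scalerA; congr (_ *: _).
  rewrite mpolyXE_id (rmorph_prod (act z)) -scaler_prod; apply: eq_bigr => i _.
  by rewrite rmorphXn /= actX exprZn.
apply: leq_trans (msize_sum _ _ _) _; apply/bigmax_leqP_seq => m mf _.
by apply: leq_trans (msizeZ_le _ _) _; rewrite msizeX; apply: msize_mdeg_lt.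
Qed.

(** A translate formed as a preimage, so that primality is immediate; if [Q] vanishes at [y], then
    [pull z Q] vanishes at the product of [z] and [y]. *)
Definition pull z Q : polyset k n := fun f => Q (act z f).

Lemma pull_prime z Q : is_prime_ideal Q -> is_prime_ideal (pull z Q).
Proof.
move=> prQ; have idQ := prime_ideal prQ; rewrite /pull; split.
- split=> [|f g hf hg|r f hf]; rewrite ?(rmorph0, rmorphD, rmorphM).
  + exact: ideal0.
  + exact: idealD hf hg.
  + exact: idealM hf.
- by rewrite rmorph1; apply: prime_N1.
- by move=> f g; rewrite rmorphM => /(primeM prQ).
Qed.

Lemma pull_chain z y Q h : (forall i, z i * y i = 1) ->
  prime_chain_to Q h -> prime_chain_to (pull z Q) h.
Proof.
move=> zy [c [pc sc ch]]; exists (fun i => pull z (c i)); split.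
- by move=> i /pc; apply: pull_prime.
- move=> i /sc [s [f [f1 f2]]]; split; first by move=> u; apply: s.
  by exists (act y f); rewrite /pull act_act act1.
- by rewrite ch.
Qed.

Lemma pull_height z y Q h : [pchar k] =i pred0 -> is_prime_ideal Q ->
  (forall i, z i * y i = 1) -> has_height Q h -> has_height (pull z Q) h.
Proof.
move=> char0 prQ zy hQ.
have prz := pull_prime z prQ; have pryz := pull_prime y prz.
have [h1 H1] := height_exists char0 prz; have [h2 H2] := height_exists char0 pryz.
have zy' i : y i * z i = 1 by rewrite mulrC.
have le1 : (h <= h1)%N by apply: H1.2; apply: pull_chain zy hQ.1.
have le2 : (h1 <= h2)%N by apply: H2.2; apply: pull_chain zy' H1.1.
have le3 : (h2 <= h)%N.
  by apply: (height_mono prQ _ H2 hQ) => f; rewrite /pull act_act act1.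
by have -> : h = h1 by lia.
Qed.

Lemma mideal_ideal : is_ideal (@mideal k n).
Proof.
split.
- by exists (fun=> 0); rewrite big1 // => i _; rewrite mul0r.
- move=> f g [c ->] [d ->]; exists (fun i => c i + d i); rewrite -big_split.
  by apply: eq_bigr => i _; rewrite mulrDl.
- move=> a f [c ->]; exists (fun i => a * c i); rewrite mulr_sumr.
  by apply: eq_bigr => i _; rewrite mulrA.
Qed.

Lemma mideal_vanish f : f.@[fun=> 1] = 0 -> mideal f.
Proof.
move=> f1; have idm := mideal_ideal.
suff H g : mideal (g - (g.@[fun=> 1])%:MP) by have := H f; rewrite f1 mpolyC0 subr0.
elim/mpolyind: g => [|c m g _ _ IH]; first by rewrite meval0 mpolyC0 subr0; apply: ideal0.
have Xm : mideal (('X_[m] : R) - 1).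
  rewrite mpolyXE_id.
  have M1 u v : mideal (u - 1) -> mideal (v - 1) -> mideal (u * v - 1).
    move=> hu hv; have -> : u * v - 1 = u * (v - 1) + (u - 1) by ring.
    by apply: idealD => //; apply: idealM.
  have one : mideal ((1 : R) - 1) by rewrite subrr; apply: ideal0.
  apply: (big_ind (fun u => mideal (u - 1))) => // i _.
  elim: (m i) => [|a IHa]; first by rewrite expr0.
  rewrite exprS; apply: M1 => //; exists (fun j => if j == i then 1 else 0).
  rewrite (bigD1 i) //= eqxx mul1r big1 ?addr0 // => j /negPf->.
  by rewrite mul0r.
have m1 : ('X_[m] : R).@[fun=> 1] = 1.
  by rewrite mevalX big1 // => i _; rewrite expr1n.
rewrite mevalD mevalZ m1 mulr1 mpolyCD opprD addrACA; apply: idealD => //.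
by rewrite -mul_mpolyC -[X in _ - X]mulr1 -mulrBr; apply: idealM.
Qed.

Lemma point_prime y : is_prime_ideal (fun f : R => f.@[y] = 0).
Proof.
split.
- split=> [|f g hf hg|r f hf]; first by rewrite meval0.
    by rewrite mevalD hf hg addr0.
  by rewrite mevalM hf mulr0.
- by rewrite meval1; apply/eqP; rewrite oner_eq0.
- by move=> f g /eqP; rewrite mevalM mulf_eq0 => /orP[]/eqP; [left | right].
Qed.

Lemma height_gt0 P f h : is_prime_ideal P -> P f -> f != 0 -> has_height P h -> (0 < h)%N.
Proof.
move=> prP Pf f0 [_ mP]; apply: mP.
pose Z : polyset k n := fun g => g = 0.
apply: (@prime_chain_extend _ _ Z P) => //.
  split; first by move=> g ->; apply: ideal0; apply: prime_ideal.
  by exists f; split=> //; apply/eqP.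
exists (fun=> Z); split=> // _ _; split.
- by split=> // [? ? -> ->|? ? ->]; rewrite ?addr0 ?mulr0.
- by apply/eqP; rewrite oner_eq0.
- by move=> g1 g2 /eqP; rewrite mulf_eq0 => /orP[]/eqP; [left | right].
Qed.

Section Powers.
Variables (m : nat) (x : 'I_m -> 'I_n -> k).
Hypothesis x0 : forall i j, x i j != 0.
Implicit Types a b : 'I_m -> int.

Lemma xpowD a b j : xpow x a j * xpow x b j = xpow x (fun i => a i + b i) j.
Proof. by rewrite /xpow -big_split; apply: eq_bigr => i _; rewrite expfzDr. Qed.

Lemma xpow0 a j : (forall i, a i = 0) -> xpow x a j = 1.
Proof. by move=> e; rewrite /xpow big1 // => i _; rewrite e expr0z. Qed.

Lemma xpow_ext a b j : a =1 b -> xpow x a j = xpow x b j.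
Proof. by move=> e; apply: eq_bigr => i _; rewrite e. Qed.

Lemma act_xpowD a b f : act (xpow x a) (act (xpow x b) f) = act (xpow x (fun i => a i + b i)) f.
Proof. by rewrite act_act; apply: act_ext => j; apply: xpowD. Qed.

Lemma xpowV a j : xpow x a j * xpow x (fun i => - a i) j = 1.
Proof. by rewrite xpowD xpow0 // => i; rewrite subrr. Qed.

End Powers.
End Torus.

(** * Ranks of sets of integer vectors *)

Section Rank.
Variable m : nat.

Definition ratmx r (v : 'I_r -> 'I_m -> int) : 'M[rat]_(r, m) := \matrix_(i, j) (v i j)%:~R.

Lemma Zindep_row_free r (v : 'I_r -> 'I_m -> int) : Zindep v -> row_free (ratmx v).
Proof.
move=> hv; apply/inj_row_free => u uV.
pose D := \prod_l denq (u 0 l).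
pose c i := numq (u 0 i) * \prod_(l | l != i) denq (u 0 l).
have cE i : (c i)%:~R = D%:~R * u 0 i.
  rewrite /c /D [X in _ = X%:~R * _](bigD1 i) //= !rmorphM /= -{3}[u 0 i]divq_num_den.
  have dn : (denq (u 0 i))%:~R != 0 :> rat by rewrite intr_eq0 denq_neq0.
  by field.
have D0 : D%:~R != 0 :> rat by rewrite intr_eq0; apply/prodf_neq0 => l _; apply: denq_neq0.
apply/rowP => i; rewrite mxE; apply: (mulfI D0); rewrite mulr0 -cE.
suff -> : c i = 0 by [].
apply: hv => j; apply/eqP; rewrite -(intr_eq0 rat) raddf_sum /=; apply/eqP.
have /rowP /(_ j) := uV; rewrite !mxE => e.
transitivity (D%:~R * \sum_l u 0 l * ratmx v l j); last by rewrite e mulr0.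
by rewrite mulr_sumr; apply: eq_bigr => l _; rewrite rmorphM /= cE mxE mulrA.
Qed.

Lemma Zindep_bound r (v : 'I_r -> 'I_m -> int) : Zindep v -> (r <= m)%N.
Proof. by move=> /Zindep_row_free /eqP <-; apply: rank_leq_col. Qed.

Lemma rank_exists (S : ('I_m -> int) -> Prop) : exists r, has_rank S r.
Proof.
pose C r := exists v : 'I_r -> 'I_m -> int, (forall i, S (v i)) /\ Zindep v.
have ex : exists r, asb (C r).
  by exists 0%N; apply/asbP; exists (fun _ _ => 0); split=> [[]|c _ []].
have bnd r : asb (C r) -> (r <= m)%N by move=> /asbP [v [_ /Zindep_bound]].
case: (ex_maxnP ex bnd) => r /asbP Cr mr; exists r; split=> // v hv vi.
by have := mr r.+1 (introT (asbP _) (ex_intro _ v (conj hv vi))); rewrite ltnn.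
Qed.

(** Pick [r] coordinates at which [v] has a nonzero minor and let [e] list the others. A vector [a]
    supported on the others does not enter a relation at the picked coordinates, so the coefficients
    of [v] vanish there first. *)
Lemma Zindep_complement r (v : 'I_r -> 'I_m -> int) : Zindep v ->
  exists2 e : 'I_(m - r) -> 'I_m, injective e & forall a : 'I_m -> int,
    (forall j, (forall l, e l != j) -> a j = 0) -> (exists j, a j != 0) ->
    Zindep (fun x : 'I_r.+1 => if unlift ord0 x is Some i then v i else a).
Proof.
move=> hv; have fV := Zindep_row_free hv.
have fT : row_full (ratmx v)^T by rewrite /row_full mxrank_tr.
pose f := fullrankfun fT; pose C := [set f l | l : 'I_r].
have cC : #|~: C| = (m - r)%N.
  by rewrite cardsCs setCK card_ord card_imset ?card_ord //; apply: fullrankfun_inj.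
have [e inj_e eC] := ord_emb cC.
exists e => // a a0 [j0 aj0] c hc.
have aC l : a (f l) = 0.
  apply: a0 => i; apply: contraTneq (eC i) => ->.
  by rewrite inE negbK imset_f.
have sumE j : c ord0 * a j + \sum_i c (lift ord0 i) * v i j = 0.
  have := hc j; rewrite big_ord_recl unlift_none => hj; apply: etrans hj; congr (_ + _).
  by apply: eq_bigr => i _; rewrite liftK.
have c1 i : c (lift ord0 i) = 0.
  pose u : 'rV[rat]_r := \row_i (c (lift ord0 i))%:~R.
  suff /rowP /(_ i) : u = 0 by rewrite !mxE => /eqP; rewrite intr_eq0 => /eqP.
  have U : (rowsub f (ratmx v)^T)^T \in unitmx by rewrite unitmx_tr fullrowsub_unit.
  rewrite -(mulmxK U u); suff -> : u *m (rowsub f (ratmx v)^T)^T = 0 by rewrite mul0mx.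
  apply/rowP => l; rewrite !mxE.
  have := sumE (f l); rewrite aC mulr0 add0r => /(congr1 (fun z : int => z%:~R : rat)).
  rewrite raddf_sum /= => e0; apply: etrans e0; apply: eq_bigr => i' _.
  by rewrite !mxE rmorphM.
move=> x; case: (unliftP ord0 x) => [i ->|->]; first exact: c1.
have := sumE j0; rewrite big1 ?addr0 => [/eqP|i _]; last by rewrite c1 mul0r.
by rewrite mulf_eq0 (negPf aj0) orbF => /eqP.
Qed.

End Rank.

(** * The zero estimate *)

Section ZeroEstimate.
Variables (k : fieldType) (n m : nat) (x : 'I_m -> 'I_n -> k) (N Q : nat) (P : {mpoly k[n]}).
Hypothesis char0 : [pchar k] =i pred0.
Hypothesis x0 : forall i j, x i j != 0.
Hypothesis P_neq0 : P != 0.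
Hypothesis nQ : (n * Q <= N)%N.
Local Notation natv b := (fun i => Posz (b i)).
Hypothesis vanish : forall b : 'I_m -> nat, (forall i, (b i <= N)%N) ->
  P.@[xpow x (natv b)] = 0.
Implicit Types (p : polyset k n) (a b c : 'I_m -> nat).

(* [p] contains the translates of [P] by [X(rQ)] and vanishes at some point of [X(N - rQ)]. *)
Definition vcond r p := [/\ is_prime_ideal p,
  (forall b, (forall i, (b i <= r * Q)%N) -> p (act (xpow x (natv b)) P)) &
  exists2 c, (forall i, (c i + r * Q <= N)%N) &
    forall f, p f -> f.@[xpow x (natv c)] = 0].

Lemma vcond_exists r : (r <= n)%N -> exists p, vcond r p.
Proof.
move=> rn; have rQ : (r * Q <= N)%N by apply: leq_trans nQ; rewrite leq_mul2r rn orbT.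
exists (fun f => f.@[xpow x (natv (fun=> 0%N))] = 0); split; first exact: point_prime.
  move=> b hb; rewrite meval_act -[RHS](vanish (b := b)) => [|i]; last exact: leq_trans (hb i) rQ.
  by apply: meval_eq => j; rewrite [X in _ * X]xpow0 // mulr1.
by exists (fun=> 0%N).
Qed.

Lemma vcondS r p : vcond r.+1 p -> vcond r p.
Proof.
case=> prp hp [c hc hv]; split=> //.
  by move=> b hb; apply: hp => i; apply: leq_trans (hb i) _; rewrite leq_mul2r leqnSn orbT.
by exists c => // i; have := hc i; lia.
Qed.

(** Translation by a point of [X(Q)] costs one unit of [r]: [a + b] stays within [r.+1 * Q], and the
    zero moves from [c] to [a + c]. *)
Lemma vcond_pull r p a : vcond r.+1 p -> (forall i, (a i <= Q)%N) ->
  vcond r (pull (xpow x (natv a)) p).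
Proof.
case=> prp hp [c hc hv] ha; split; first exact: pull_prime.
  move=> b hb; rewrite /pull act_xpowD //.
  rewrite (_ : act _ P = act (xpow x (natv (fun i => a i + b i)%N)) P).
    by apply: hp => i; rewrite mulSn; apply: leq_add.
  by apply: act_ext => j; apply: xpow_ext => i; rewrite PoszD.
exists (fun i => a i + c i)%N => [i|f /hv]; first by have := hc i; have := ha i; lia.
rewrite meval_act => e; rewrite -[RHS]e; apply: meval_eq => j.
by rewrite xpowD //; apply: xpow_ext => i; rewrite PoszD.
Qed.

Lemma stationary_height : exists r p h,
  [/\ (0 < h)%N, vcond r.+1 p, has_height p h &
      forall p' h', vcond r p' -> has_height p' h' -> (h <= h')%N].
Proof.
pose ish r h := (exists2 p, vcond r p & has_height p h) /\
  forall p' h', vcond r p' -> has_height p' h' -> (h <= h')%N.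
have ex r : exists h, (r <= n)%N -> ish r h.
  have [rn|nr] := leqP r n; last by exists 0%N.
  have [p cp] := vcond_exists rn.
  have ex : exists h, asb (exists2 p, vcond r p & has_height p h).
    have prp : is_prime_ideal p by case: cp.
    by have [h hh] := height_exists char0 prp; exists h; apply/asbP; exists p.
  case: (ex_minnP ex) => h /asbP hp mh; exists h => _; split=> // p' h' c' h''.
  by apply: mh; apply/asbP; exists p'.
pose H r := proj1_sig (constructive_indefinite_description _ (ex r)).
have HP r : (r <= n)%N -> ish r (H r).
  exact: (proj2_sig (constructive_indefinite_description _ (ex r))).
have H0 : (0 < H 0%N)%N.
  have [[p [prp hp _] hh] _] := HP 0%N (leq0n n).
  have : p (act (xpow x (natv (fun=> 0%N))) P) by apply: hp.
  rewrite act1 => [pP|j]; last exact: xpow0.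
  exact: height_gt0 prp pP P_neq0 hh.
have Hn : (H n <= n)%N.
  by have [[p [prp _ _] hh] _] := HP n (leqnn n); apply: height_leq_nvars hh.
have mono r : (r < n)%N -> (H r <= H r.+1)%N.
  move=> rn; have [[p cp hh] _] := HP r.+1 rn; have [_ h] := HP r (ltnW rn).
  by apply: h hh; apply: vcondS.
(* A strictly increasing [H] with [H 0] positive would exceed [n] at index [n]. *)
have [r rn e] : exists2 r, (r < n)%N & H r = H r.+1.
  apply: NNPP => hn; suff K r : (r <= n)%N -> (r < H r)%N.
    by have := K n (leqnn n); rewrite ltnNge Hn.
  elim: r => // r IH rn; apply: leq_ltn_trans (IH (ltnW rn)) _.
  rewrite ltn_neqAle mono // andbT; apply/eqP => e; apply: hn; by exists r.
have [[p cp hh] _] := HP r.+1 rn; have [_ h] := HP r (ltnW rn).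
exists r, p, (H r.+1); split=> //; last by rewrite -e.
apply: leq_trans H0 _; elim: r.+1 rn {e p cp hh h} => // l IH ln.
by apply: leq_trans (IH (ltnW ln)) (mono _ ln).
Qed.

Lemma zero_estimate d : (0 < d)%N -> (msize P <= d.+1)%N -> exists (p : polyset k n) h r,
  [/\ is_prime_ideal p /\ subset_ideal p (@mideal k n), has_height p h, has_rank (Stab x p) r,
      (0 < h)%N & ((Q.+1 ^ (m - r)) <= d ^ h)%N].
Proof.
move=> d0 sP; have [r [p [h [h0 cp hp mh]]]] := stationary_height.
have [prp _ [c _ pc]] := cp.
(* Translating by the inverse of the zero [x^c] of [p] moves this zero to the point 1. *)
pose nc i : int := - Posz (c i).
pose p1 := pull (xpow x nc) p.
have hpull (a : 'I_m -> int) : has_height (pull (xpow x a) p) h.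
  by apply: (pull_height char0 prp _ hp) => j; apply: (xpowV x0).
have prpull (a : 'I_m -> int) : is_prime_ideal (pull (xpow x a) p) by apply: pull_prime.
have [s hs] := rank_exists (Stab x p1).
exists p1, h, s; split=> //.
  split=> [|f /pc]; first exact: prpull.
  rewrite meval_act => e; apply: mideal_vanish.
  rewrite -[RHS]e; apply: meval_eq => j; rewrite xpowD // xpow0 // => i.
  by rewrite /nc addNr.
  exact: hpull.
have [[v [vS vi]] maxs] := hs.
have [e inj_e he] := Zindep_complement vi.
pose B := {ffun 'I_(m - s) -> 'I_Q.+1}.
pose ab (b : B) i : nat := expmon e (fun l => b l) i.
have abQ (b : B) i : (ab b i <= Q)%N.
  rewrite /ab; case: (pickP (fun l => e l == i)) => [l /eqP <-|hl].
    by rewrite expmonE // -ltnS.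
  by rewrite expmon_out // => l; rewrite hl.
pose q (b : B) := pull (xpow x (natv (ab b))) p.
(* If two translates coincide, the difference of their exponents stabilises [p1]; supported on the
   coordinates listed by [e], it is independent of [v] unless zero, and would raise the rank. *)
have distinct (b b' : B) : subset_ideal (q b) (q b') -> subset_ideal (q b') (q b) -> b = b'.
  move=> s1 s2; apply: NNPP => /eqP bb'.
  pose a i : int := Posz (ab b' i) - Posz (ab b i).
  have aS : Stab x p1 a.
    have mv u1 u2 f : subset_ideal (q u1) (q u2) -> p1 f ->
        p1 (act (xpow x (fun i => Posz (ab u2 i) - Posz (ab u1 i))) f).
      move=> su hf.
      have : q u1 (act (xpow x (fun i => nc i - Posz (ab u1 i))) f).
        rewrite /q /pull act_xpowD // (_ : act _ f = act (xpow x nc) f) //.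
        by apply: act_ext => j; apply: xpow_ext => i; rewrite addrC subrK.
      move=> /su; rewrite /q /p1 /pull !act_xpowD // => h1.
      rewrite (_ : act _ f = act (xpow x (fun i => Posz (ab u2 i) + (nc i - Posz (ab u1 i)))) f) //.
      by apply: act_ext => j; apply: xpow_ext => i; rewrite addrCA.
    split; first by move=> f; apply: mv.
    move=> g hg; exists (act (xpow x (fun i => Posz (ab b i) - Posz (ab b' i))) g).
    split; first exact: mv.
    rewrite act_xpowD // act1 // => j; apply: xpow0 => i.
    by rewrite /a addrA subrK subrr.
  apply: (maxs (fun y => if unlift ord0 y is Some i then v i else a)).
    by move=> y; case: (unliftP ord0 y) => [i _|_].
  apply: he.
    by move=> j hj; rewrite /a /ab !expmon_out // subrr.
  have [l bl] : exists l, b l != b' l.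
    apply/existsP; apply: contraR bb'; rewrite negb_exists => /forallP hl.
    by apply/eqP/ffunP => l; apply/eqP; rewrite -[_ == _]negbK hl.
  exists (e l); rewrite /a /ab !expmonE // subr_eq0 eqz_nat eq_sym.
  by apply: contra bl => /eqP/val_inj->.
pose L := {ffun 'I_m -> 'I_(r * Q).+1}.
pose F (l : L) := act (xpow x (fun i => Posz (l i))) P.
have -> : (Q.+1 ^ (m - s) = #|{: B}|)%N by rewrite card_ffun !card_ord.
apply: (@minimal_primes_count k n char0 d h #|{: B}| L F (fun j => q (enum_val j))) => //.
- by move=> l; apply: leq_trans (msize_act _ _) sP.
- by move=> j; apply: prpull.
- by move=> j; apply: hpull.
- move=> j l; have [_ hl _] := vcond_pull cp (abQ (enum_val j)).
  by apply: (hl (fun i => val (l i))) => i; rewrite -ltnS; apply: ltn_ord.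
(* A prime inside a translate of [p] inherits its zero; if it contains all [F l], it satisfies
   [vcond r] and so has height at least [h]. Here the equality of two consecutive least heights
   enters. *)
- move=> j p' prp' Fp' p'q; have [h' hh'] := height_exists char0 prp'.
  apply: (same_height_eq (prpull _) p'q hh' (hpull _)); apply: mh hh'; split=> //.
    move=> b hb; have hb' i : (b i < (r * Q).+1)%N by rewrite ltnS.
    have := Fp' [ffun i => Ordinal (hb' i)].
    by rewrite /F (_ : act _ P = act (xpow x (natv b)) P) //; apply: act_ext => i;
      apply: xpow_ext => i'; rewrite ffunE.
  have [_ _ [c' hc' hv']] := vcond_pull cp (abQ (enum_val j)).
  by exists c' => // f /p'q /hv'.
- move=> j l jl; apply: NNPP => hn.
  have sub : subset_ideal (q (enum_val l)) (q (enum_val j)).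
    by move=> f fl; apply: NNPP => fj; apply: hn; exists f.
  have sub' := same_height_eq (prpull _) sub (hpull _) (hpull _) (leqnn _).
  by move/eqP: jl; apply; apply: enum_val_inj; apply: distinct.
Qed.

End ZeroEstimate.

(** Otherwise [m * h <= (m - r) * n]. Since [y = N/n] exceeds 1 and is at most [q = (N %/ n).+1],
    this gives [y^(mh) <= y^((m-r)n) <= q^((m-r)n) <= d^(hn) < y^(mh)]. *)
Lemma exponent_comparison (n m h r d N : nat) : (0 < n)%N -> (0 < m)%N -> (0 < d)%N -> (0 < h)%N ->
  d%:Q ^+ n < (N%:Q / n%:Q) ^+ m -> ((N %/ n).+1 ^ (m - r) <= d ^ h)%N ->
  r%:Q / m%:Q + h%:Q / n%:Q > 1.
Proof.
move=> n0 m0 d0 h0; set y : rat := N%:Q / n%:Q => dy cnt.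
have n0q : 0 < n%:Q :> rat by rewrite ltr0z.
have m0q : 0 < m%:Q :> rat by rewrite ltr0z.
have y0 : 0 <= y by rewrite divr_ge0 // ler0z.
have y1 : 1 < y.
  rewrite ltNge; apply/negP => yl1; move: dy; rewrite ltNge => /negP; apply.
  apply: (@le_trans _ _ 1); first by rewrite exprn_ile1.
  by rewrite exprn_ege1 // ler1z; lia.
have yQ : y <= (N %/ n).+1%:Q.
  rewrite ler_pdivrMr // -intrM ler_int; have := ltn_ceil N n0; lia.
suff : (m * n < r * n + h * m)%N.
  move=> H; rewrite -(ltr_pM2r (mulr_gt0 m0q n0q)) mul1r.
  have -> : (r%:Q / m%:Q + h%:Q / n%:Q) * (m%:Q * n%:Q) = r%:Q * n%:Q + h%:Q * m%:Q.
    by field; rewrite !gt_eqF.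
  by rewrite -!intrM -intrD ltr_int; lia.
rewrite ltnNge; apply/negP => le.
have le' : (m * h <= (m - r) * n)%N by rewrite mulnBl; nia.
have : y ^+ (m * h) < (y ^+ m) ^+ h; last by rewrite exprM ltxx.
apply: (@le_lt_trans _ _ ((d%:Q ^+ n) ^+ h)); last by rewrite ltr_pXn2r // nnegrE ?exprn_ge0 // ler0z.
apply: (@le_trans _ _ (y ^+ ((m - r) * n))); first by rewrite ler_weXn2l // ltW.
rewrite -exprM mulnC mulnC [X in _ <= _ ^+ X]mulnC 2!exprM.
apply: lerXn2r; rewrite ?nnegrE ?exprn_ge0 ?ler0z //.
apply: (@le_trans _ _ ((N %/ n).+1%:Q ^+ (m - r))).
  by apply: lerXn2r; rewrite ?nnegrE ?ler0z.
by rewrite -!natrX !pmulrn ler_int.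
Qed.


Theorem theorem5p10 (k : fieldType) (n m : nat) (x : 'I_m -> 'I_n -> k) (N : nat) :
  [pchar k] =i pred0 ->
  (0 < n)%N -> (0 < m)%N ->
  (forall i j, x i j != 0) ->
  (0 < N)%N ->
  (exists P : {mpoly k[n]},
     [/\ P != 0,
         (* deg P < (N/n)^(m/n), raised to the n-th power (both sides >= 0) *)
         (totdeg P)%:Q ^+ n < (N%:Q / n%:Q) ^+ m &
         forall b : 'I_m -> nat, (forall i, (b i <= N)%N) ->
           meval (fun j : 'I_n => \prod_(i < m) x i j ^+ b i) P = 0]) ->
  exists (p : polyset k n) (n' m' : nat),
    [/\ is_prime_ideal p, subset_ideal p (@mideal k n), has_height p n',
        has_rank (Stab x p) m' &
        m'%:Q / m%:Q + n'%:Q / n%:Q > 1].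
Proof.
move=> char0 n0 m0 x0 N0 [P [P0 degP vanish]].
(* A constant that vanishes at the point 1, the case [b = 0], is zero; so [P] has positive
   degree. *)
have d0 : (0 < totdeg P)%N.
  rewrite /totdeg lt0n; apply: contra P0 => /eqP s1.
  have /msize1_polyC eP : (msize P <= 1)%N by case: (msize P) s1 => [|[]].
  have := vanish (fun=> 0%N) (fun=> leq0n N); rewrite eP mevalC => ->.
  by rewrite mpolyC0.
have sP : (msize P <= (totdeg P).+1)%N by rewrite /totdeg -mpolySpred.
have nQ : (n * (N %/ n) <= N)%N by rewrite mulnC leq_divM.
have [p [h [r [[prp pm] hp hr h0 cnt]]]] := zero_estimate char0 x0 P0 nQ vanish d0 sP.
exists p, h, r; split=> //.
exact: exponent_comparison degP cnt.
Qed.
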